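(* Let $n\ge 1$, $m=n(n+1)/2$ and $\ell\geq 2m$. For almost all choices of $(R_1,\ldots,R_\ell)\in SPD(n)^\ell$ (with respect to Lebesgue measure), the set $$S_{R_1,\ldots,R_\ell}=\{P\in SPD(n):\operatorname{rank}(\log_P R_1,\ldots,\log_P R_\ell)<m\}$$ is empty. In other words, the map $F:SPD(n)\to\mathbb{R}^\ell$, $F(P)=(d(R_1,P)^2,\ldots,d(R_\ell,P)^2)$, is locally invertible on $SPD(n)$.
   Context: $Sym(n)$ is the $m$-dimensional real vector space of real symmetric $n\times n$ matrices and $SPD(n)\subset Sym(n)$ the open subset of positive definite ones; $SPD(n)^\ell$ carries the Lebesgue measure of $Sym(n)^\ell\cong\mathbb{R}^{m\ell}$. $SPD(n)$ is equipped with the affine-invariant Riemannian metric $\langle V,W\rangle_P=\operatorname{Tr}(P^{-1}VP^{-1}W)$ for $V,W\in T_PSPD(n)\cong Sym(n)$. Its Riemannian distance is $d(P,Q)=\left(\operatorname{Tr}\big(\log(P^{-1/2}QP^{-1/2})^2\big)\right)^{1/2}$, and its Riemannian logarithm is $\log_P(Q)=P^{1/2}\log(P^{-1/2}QP^{-1/2})P^{1/2}\in Sym(n)$, where $\log$ without subscript is the matrix logarithm. $\operatorname{rank}(\log_P R_1,\ldots,\log_P R_\ell)$ is the dimension of the linear span of these matrices in $Sym(n)$. $F$ is called locally invertible at $P$ if its differential $DF(P)$ has rank $m$ (so that $F$ is a diffeomorphism from a neighborhood of $P$ onto the image of that neighborhood), and locally invertible on $SPD(n)$ if this holds at every $P\in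 SPD(n)$. *)

(* Defs.v *)
(* MathComp-Analysis; the reals are an arbitrary [R : realType]. *)
From HB Require Import structures.
From mathcomp Require Import all_boot all_order all_algebra.
From mathcomp Require Import all_classical all_reals all_analysis.

Set Implicit Arguments.
Unset Strict Implicit.
Unset Printing Implicit Defensive.

Import Order.TTheory GRing.Theory Num.Theory.
Import numFieldNormedType.Exports.

Local Open Scope classical_set_scope.
Local Open Scope ring_scope.

Definition symdim (n : nat) : nat := ((n * n.+1) %/ 2)%N.

Definition upper (n : nat) := {p : 'I_n * 'I_n | (p.1 <= p.2)%N}.

Lemma card_upper n : #|{: upper n}| = symdim n.
Proof.
rewrite card_sig -sum1_card.
rewrite (eq_bigl (fun p : 'I_n * 'I_n => xpredT p.1 && (p.1 <= p.2)%N)) //.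
rewrite -(pair_big_dep xpredT (fun i j : 'I_n => (i <= j)%N) (fun _ _ => 1%N)) /=.
rewrite (eq_bigr (fun i : 'I_n => (n - i)%N)); last first.
  move=> i _; rewrite -(big_mkord (fun j => i <= j)%N (fun _ => 1%N)).
  rewrite (big_cat_nat _ (n := i)) //=; last exact: ltnW.
  rewrite big_nat_cond big_pred0; last first.
    by move=> j; case: (ltnP j i) => //=; rewrite andbF.
  rewrite big_nat_cond (eq_bigl (fun j => (i <= j < n)%N)); last first.
    by move=> j; case: (leqP i j); rewrite ?andbT ?andbF.
  by rewrite -big_nat sum_nat_const_nat muln1 add0n.
rewrite -(big_mkord xpredT (fun i => (n - i)%N)) big_nat_rev /= add0n.
rewrite big_nat (eq_bigr (fun i => i.+1)); last first.
  by move=> i /andP[_ lin]; rewrite subKn.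
rewrite -big_nat -(big_add1 _ _ 0 n.+1 xpredT id) /=.
have := bin2_sum n.+1; rewrite big_nat_recl// add0n big_add1 /= => ->.
by rewrite /symdim bin2 /= mulnC divn2.
Qed.

Section Sym.
Context (R : realType) (n : nat).

Definition is_symmx : {pred 'M[R]_n} := fun A => A^T == A.

Fact is_symmx_submod : submod_closed is_symmx.
Proof.
split=> [|a A B /eqP hA /eqP hB]; first by rewrite unfold_in trmx0.
by rewrite unfold_in linearD linearZ /= hA hB.
Qed.

HB.instance Definition _ :=
  GRing.isSubmodClosed.Build R 'M[R]_n is_symmx is_symmx_submod.

Record Sym := MkSym { sym_mx :> 'M[R]_n; _ : sym_mx \in is_symmx }.

HB.instance Definition _ := [isSub for sym_mx].
HB.instance Definition _ := [Choice of Sym by <:].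
HB.instance Definition _ := [SubChoice_isSubZmodule of Sym by <:].
HB.instance Definition _ := [SubZmodule_isSubLmodule of Sym by <:].

Lemma tr_sym (A : Sym) : (sym_mx A)^T = A.
Proof. by apply/eqP; exact: (valP A). Qed.

(* The isomorphism Sym(n) ~ R^m: a symmetric matrix is given by its entries on
   and above the diagonal. *)
Definition sym_coord (A : Sym) (p : upper n) : R := sym_mx A (val p).1 (val p).2.

Lemma sym_coord_inj (A B : Sym) : sym_coord A =1 sym_coord B -> A = B.
Proof.
move=> h; apply/val_inj/matrixP => i j /=.
have [ij|/ltnW ji] := leqP i j; first exact: (h (exist _ (i, j) ij)).
have := h (exist _ (j, i) ji); rewrite /sym_coord /=.
by rewrite -[in X in X = _](tr_sym A) -[in X in _ = X](tr_sym B) !mxE.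
Qed.

Fact of_coord_subproof (c : upper n -> R) :
  (\matrix_(i, j) if insub (if (i <= j)%N then (i, j) else (j, i)) is Some p
                  then c p else 0) \in is_symmx.
Proof.
apply/eqP/matrixP => i j; rewrite !mxE.
by case: (ltngtP i j) => // /val_inj ->.
Qed.

Definition of_coord (c : upper n -> R) : Sym := MkSym (of_coord_subproof c).

Lemma of_coordK c : sym_coord (of_coord c) =1 c.
Proof.
move=> [[i j] ij]; rewrite /sym_coord mxE /= [X in if X then _ else _]ij.
by rewrite insubT; congr c; exact: val_inj.
Qed.

Fact sym_vect_axiom : Vector.axiom (symdim n) Sym.
Proof.
rewrite -card_upper.
exists (fun A => \row_k sym_coord A (enum_val k)).
  by move=> a A B; apply/rowP => k; rewrite !mxE /sym_coord /= !mxE.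
exists (fun v : 'rV_#|{: upper n}| => of_coord (fun p => v 0 (enum_rank p))).
  move=> A; apply: sym_coord_inj => p.
  by rewrite of_coordK mxE enum_rankK.
by move=> v; apply/rowP => k; rewrite mxE of_coordK enum_valK.
Qed.

HB.instance Definition _ := Lmodule_hasFinDim.Build R Sym sym_vect_axiom.

Fact sym_normr0_eq0 (A : Sym) : `|sym_mx A| = 0 -> A = 0.
Proof. by move=> /normr0_eq0 A0; exact: val_inj. Qed.

HB.instance Definition _ := @Lmodule_isNormed.Build R Sym
  (fun A => `|sym_mx A|) (fun A B => ler_normD (sym_mx A) B)
  (fun a A => normrZ a (sym_mx A))
  sym_normr0_eq0.

Lemma dim_Sym : \dim {: Sym} = symdim n.
Proof. by rewrite dimvf. Qed.

Definition SPD : set Sym :=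
  [set P | forall v : 'cV[R]_n, v != 0 -> 0 < (v^T *m sym_mx P *m v) 0 0].

End Sym.

Section Geometry.
Context (R : realType) (n : nat).
Implicit Types (A P Q : 'M[R]_n) (f : R -> R).

(* Functional calculus on symmetric matrices: if [A = U^T diag(d) U] with [U]
   orthogonal, then [mxfun f A = U^T diag(f d) U]. The value does not depend on
   the diagonalization ([mxfunE] below); on matrices that are not
   orthogonally diagonalizable it is a default value. *)
Definition mxfun f A : 'M[R]_n :=
  get [set B | exists (U : 'M[R]_n) (d : 'rV[R]_n),
    [/\ U *m U^T = 1%:M,
        A = U^T *m diag_mx d *m U &
        B = U^T *m diag_mx (map_mx f d) *m U]].

Lemma mxfunE f (U : 'M[R]_n) (d : 'rV[R]_n) : U *m U^T = 1%:M ->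
  mxfun f (U^T *m diag_mx d *m U) = U^T *m diag_mx (map_mx f d) *m U.
Proof.
move=> UU; rewrite /mxfun; case: xgetP => [B _|/(_ (U^T *m diag_mx (map_mx f d) *m U))]; last first.
  by case; exists U, d.
move=> [V [e [VV AE ->]]].
have UU' := mulmx1C UU; have VV' := mulmx1C VV.
pose W := V *m U^T.
have WE : W *m diag_mx d = diag_mx e *m W.
  have : V *m (U^T *m diag_mx d *m U) *m U^T = V *m (V^T *m diag_mx e *m V) *m U^T.
    by rewrite AE.
  by rewrite !mulmxA VV mul1mx -!mulmxA UU mulmx1.
have WfE : W *m diag_mx (map_mx f d) = diag_mx (map_mx f e) *m W.
  apply/matrixP => i j; move/matrixP/(_ i j): WE.
  rewrite !mul_mx_diag !mul_diag_mx [_ i j]mxE [RHS]mxE => WE.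
  rewrite [LHS]mxE [RHS]mxE [map_mx f d _ _]mxE [map_mx f e _ _]mxE.
  move: WE; move: (W i j) => w /eqP; rewrite mulrC -subr_eq0 -mulrBl mulf_eq0.
  by case/orP => [/eqP/subr0_eq ->|/eqP ->]; rewrite ?mulr0 ?mul0r// mulrC.
have VE : V = W *m U by rewrite /W -mulmxA UU' mulmx1.
have WW : W^T *m W = 1%:M.
  by rewrite /W trmx_mul trmxK -mulmxA [V^T *m _]mulmxA VV' mul1mx.
clearbody W; rewrite VE trmx_mul.
rewrite -!mulmxA [X in _ *m (_ *m X)]mulmxA -WfE -mulmxA.
by rewrite [X in _ *m X]mulmxA WW mul1mx.
Qed.

Definition mxsqrt P := mxfun Num.sqrt P.

Definition mxlog P := mxfun (@ln R) P.

(* P^{-1/2} Q P^{-1/2} *)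
Definition whiten P Q := invmx (mxsqrt P) *m Q *m invmx (mxsqrt P).

(* Distance and logarithm of the affine-invariant Riemannian metric
   <V, W>_P = Tr(P^{-1} V P^{-1} W), by their closed formulas. *)
Definition spd_dist P Q : R :=
  let L := mxlog (whiten P Q) in Num.sqrt (\tr (L *m L)).

Definition spd_log P Q : 'M[R]_n := mxsqrt P *m mxlog (whiten P Q) *m mxsqrt P.

Definition log_rank l (Rs : 'I_l -> Sym R n) P : nat :=
  \dim <<[seq spd_log P (Rs i) | i : 'I_l]>>%VS.

Definition degenerate_set l (Rs : 'I_l -> Sym R n) : set (Sym R n) :=
  [set P | SPD P /\ (log_rank Rs P < symdim n)%N].

Definition sqdist_map l (Rs : 'I_l -> Sym R n) (P : Sym R n) : 'rV[R]_l :=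
  \row_i spd_dist (Rs i) P ^+ 2.

Definition locally_invertible_at l (F : Sym R n -> 'rV[R]_l) (P : Sym R n) :=
  differentiable F P /\ \dim (limg (linfun ('d F P))) = symdim n.

End Geometry.

Section Lebesgue.
Context (R : realType) (I : finType).
Implicit Types (a b : I -> R).

Definition box a b : set (I -> R) := [set x | forall i, a i <= x i <= b i].

(* Lebesgue outer measure on R^I, through countable covers by boxes. *)
Definition lebesgue_outer (A : set (I -> R)) : \bar R :=
  ereal_inf [set s | exists a b : nat -> I -> R,
    [/\ forall k i, a k i <= b k i,
        A `<=` \bigcup_k box (a k) (b k) &
        s = (\sum_(0 <= k <oo) (\prod_i (b k i - a k i))%:E)%E]].

Definition lebesgue_null (A : set (I -> R)) := lebesgue_outer A = 0%E.

End Lebesgue.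

Definition tuple_coord (R : realType) (n l : nat) (Rs : 'I_l -> Sym R n)
    (p : 'I_l * upper n) : R :=
  sym_coord (Rs p.1) p.2.

(* [T] holds for almost all tuples in SPD(n)^l, for the Lebesgue measure of
   Sym(n)^l ~ R^(m * l). *)
Definition almost_all_SPD (R : realType) (n l : nat)
    (T : ('I_l -> Sym R n) -> Prop) : Prop :=
  lebesgue_null (@tuple_coord R n l @`
    [set Rs | (forall i, SPD (Rs i)) /\ ~ T Rs]).

(* Main.v *)
(* For fixed P the vectors log_P(R_i) fail to span Sym(n) exactly when they all lie
   in one hyperplane. Writing S for the square root of P this means R_i = S exp(X_i) S
   with all X_i in a common hyperplane, so the bad tuples are covered by finitely many
   locally Lipschitz images of a space of dimension m + (m - 1) + l (m - 1), which is
   less than l m when l >= 2 m. Such images are null.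
   For two symmetric matrices with spectral decompositions A = U^T D U and
   B = V^T E V, the squares w_ij of the entries of V U^T have row and column sums 1, and
   |f(B) - f(A)|^2 = \sum_ij w_ij (f(e_i) - f(d_j))^2, while
   Tr f(B) - Tr f(A) - Tr (f'(A) (B - A)) is the w-weighted sum of the scalar Taylor
   remainders. So scalar estimates give both the local Lipschitz bound for exp and the
   differential of d(R, .)^2 = Tr (ln^2 (R^-1/2 . R^-1/2)), namely
   V |-> - 2 Tr (P^-1 log_P(R) P^-1 V). When the log_P(R_i) span, this is injective. *)
Require Import Defs.
From HB Require Import structures.
From mathcomp Require Import all_boot all_order all_algebra.
From mathcomp Require Import all_classical all_reals all_analysis.
From mathcomp Require Import complex ring lra zify.

Set Implicit Arguments.
Unset Strict Implicit.
Unset Printing Implicit Defensive.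

Import Order.TTheory GRing.Theory Num.Theory.
Import numFieldNormedType.Exports.
Local Open Scope classical_set_scope.
Local Open Scope ring_scope.

(** * Spectral theorem over the reals *)

Section Spectral.
Variable R : realType.

(** Over the complex numbers [A] is Hermitian, so its spectral diagonal is real and the first row of
    the spectral matrix is an eigenvector. A real root of the complexified characteristic polynomial
    is a root of the real one. *)
Lemma symmetric_eigenvalue n (A : 'M[R]_n.+1) : A^T = A -> exists a, eigenvalue A a.
Proof.
move=> sA; pose Ac : 'M[R[i]]_n.+1 := map_mx (real_complex R) A.
have Ah : Ac \is hermsymmx.
  apply: realsym_hermsym.
    apply/is_hermitianmxP; rewrite expr0 scale1r map_mx_id //.
    by rewrite /Ac map_trmx sA.
  apply/mxOverP => i j; rewrite mxE /= complex_real //.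
have := hermitian_spectral_diag_real Ah => /mxOverP /(_ 0 0) dR.
have /hermitian_normalmx /orthomx_spectralP AE := Ah.
have Pu := spectral_unit Ac.
set P := spectralmx Ac in AE Pu; set D := spectral_diag Ac in AE dR.
have : eigenvalue Ac (D 0 0).
  apply/eigenvalueP; exists (row 0 P).
    rewrite -row_mul [in LHS]AE !mulmxA mulmxV // mul1mx mul_diag_mx.
    by apply/rowP => j; rewrite !mxE.
  apply/negP => /eqP r0.
  have : row 0 (P *m invmx P) = 0 by rewrite row_mul r0 mul0mx.
  rewrite mulmxV // => /rowP/(_ 0); rewrite !mxE eqxx => /eqP.
  by rewrite oner_eq0.
rewrite eigenvalue_root_char -map_char_poly.
have -> : D 0 0 = real_complex R (complex.Re (D 0 0)) by rewrite complex.RRe_real.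
by rewrite fmorph_root -eigenvalue_root_char => h; exists (complex.Re (D 0 0)).
Qed.

Lemma trmx_mul_ge0 n (w : 'cV[R]_n) : 0 <= (w^T *m w) 0 0.
Proof. by rewrite mxE sumr_ge0 // => i _; rewrite mxE -expr2 sqr_ge0. Qed.

Lemma trmx_mul_eq0 n (w : 'cV[R]_n) : ((w^T *m w) 0 0 == 0) = (w == 0).
Proof.
apply/idP/eqP => [|->]; last by rewrite mulmx0 mxE.
rewrite mxE psumr_eq0 => [/allP h|i _]; last by rewrite mxE -expr2 sqr_ge0.
apply/colP => i; rewrite mxE; apply/eqP.
by have := h i (mem_index_enum _); rewrite /= mxE mulf_eq0 orbb.
Qed.

(** [H] is the reflection in the hyperplane orthogonal to [e - v], or the identity when [e = v]. *)
Lemma householder n (e v : 'cV[R]_n) :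
  (e^T *m e) 0 0 = 1 -> (v^T *m v) 0 0 = 1 ->
  exists H : 'M[R]_n, [/\ H^T = H, H *m H = 1%:M & H *m e = v].
Proof.
move=> e1 v1; have [->|ev] := eqVneq e v.
  by exists 1%:M; rewrite trmx1 mulmx1 mul1mx.
pose w := e - v; pose s := (w^T *m w) 0 0.
have s0 : s != 0 by rewrite /s trmx_mul_eq0 subr_eq0.
have scal (a b : 'cV[R]_n) : a^T *m b = ((a^T *m b) 0 0)%:M by rewrite -mx11_scalar.
exists (1%:M - (2 / s) *: (w *m w^T)); split.
- by rewrite linearB /= linearZ /= trmx1 trmx_mul trmxK.
- rewrite mulmxBl mul1mx mulmxBr mulmx1 -!scalemxAl -!scalemxAr.
  rewrite mulmxA -[w *m w^T *m w]mulmxA scal -/s mul_mx_scalar -scalemxAl.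
  rewrite !scalerA -addrA -opprD -scalerBl -scalerDl.
  have -> : 2 / s + (2 / s - 2 / s * (2 / s * s)) = 0 by field.
  by rewrite scale0r subr0.
- rewrite mulmxBl mul1mx -scalemxAl -mulmxA [w^T *m e]scal mul_mx_scalar scalerA.
  have ve : (v^T *m e) 0 0 = (e^T *m v) 0 0.
    by rewrite -[v^T *m e]trmxK trmx_mul trmxK mxE.
  (* For unit vectors |e - v|^2 = 2 - 2 <e, v> = 2 <e - v, e>, so [H] subtracts exactly [w] from
     [e]. *)
  have sE : s = 2 * (w^T *m e) 0 0.
    rewrite /s /w [(e - v)^T]linearB /= !mulmxBl !mulmxBr.
    rewrite !mxE in e1 v1 ve *; lra.
  suff -> : 2 / s * (w^T *m e) 0 0 = 1 by rewrite scale1r /w subKr.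
  by rewrite mulrAC -sE mulfV.
Qed.

Lemma block_diagonalizable n (a : R) (C V : 'M[R]_n) (d : 'rV[R]_n) :
  V *m V^T = 1%:M -> C = V^T *m diag_mx d *m V ->
  let W : 'M[R]_(1 + n) := block_mx 1%:M 0 0 V in
  W *m W^T = 1%:M /\
  block_mx a%:M 0 0 C = W^T *m diag_mx (row_mx a%:M d) *m W.
Proof.
move=> VV -> /=; rewrite tr_block_mx !trmx0 trmx1 diag_mx_row !mulmx_block.
rewrite !(mulmx0, mul0mx, mul1mx, mulmx1, addr0, add0r) VV.
split; first by rewrite -scalar_mx_block.
by congr block_mx; apply/matrixP => i j; rewrite !ord1 !mxE.
Qed.

(** Deflation: a Householder reflection carries the first basis vector to a unit eigenvector, so
    conjugating by it splits off the eigenvalue and leaves a smaller symmetric block for the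
    induction. *)
Lemma symmetric_diagonalizable n (A : 'M[R]_n) : A^T = A ->
  exists (U : 'M[R]_n) (d : 'rV[R]_n), U *m U^T = 1%:M /\ A = U^T *m diag_mx d *m U.
Proof.
elim: n A => [|n IHn] A sA.
  by exists 1%:M, 0; rewrite trmx1 mulmx1; split=> //; rewrite [LHS]flatmx0 [RHS]flatmx0.
have [a /eigenvalueP[u uA u0]] := symmetric_eigenvalue sA.
pose r := Num.sqrt ((u *m u^T) 0 0).
have uu : 0 < (u *m u^T) 0 0.
  rewrite -{1}[u]trmxK lt_neqAle eq_sym trmx_mul_ge0 trmx_mul_eq0 andbT.
  by rewrite trmx_eq0.
have r0 : r != 0 by rewrite sqrtr_eq0 -ltNge.
have rr : r * r = (u *m u^T) 0 0 by rewrite -expr2 sqr_sqrtr ?ltW.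
pose v := r^-1 *: u^T.
have v1 : (v^T *m v) 0 0 = 1.
  rewrite /v [(_ *: _)^T]linearZ /= trmxK -scalemxAl -scalemxAr scalerA mxE -rr.
  by field.
have Av : A *m v = a *: v.
  by rewrite /v -scalemxAr -{1}sA -trmx_mul uA linearZ /= scalerA mulrC -scalerA.
pose e : 'cV[R]_n.+1 := delta_mx 0 0.
have e1 : (e^T *m e) 0 0 = 1 by rewrite trmx_delta mul_delta_mx mxE !eqxx.
have [H [HT HH He]] := householder e1 v1.
pose B : 'M[R]_(1 + n) := H *m A *m H.
have BT : B^T = B by rewrite /B !trmx_mul HT sA mulmxA.
have Be : B *m e = a *: e.
  by rewrite /B -!mulmxA He Av -scalemxAr -He mulmxA HH mul1mx.
have AB : A = H *m B *m H by rewrite /B !mulmxA HH mul1mx -mulmxA HH mulmx1.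
clearbody B.
have Bcol (i j : 'I_(1 + n)) : j = 0%N :> nat -> B i j = a * (i == 0 :> nat)%:R.
  move=> j0; have -> : j = ord0 by apply/val_inj.
  have /colP/(_ i) := Be; rewrite -colE !mxE andbT => ->; exact: erefl.
have Bl : dlsubmx B = 0.
  by apply/colP => i; rewrite !mxE Bcol ?mulr0.
have Br : ursubmx B = 0 by rewrite -[ursubmx B]trmxK trmx_ursub BT Bl trmx0.
have Bu : ulsubmx B = a%:M.
  by rewrite [LHS]mx11_scalar; congr (_%:M); rewrite !mxE Bcol ?mulr1.
have sC : (drsubmx B)^T = drsubmx B by rewrite trmx_drsub BT.
have [V [d [VV CE]]] := IHn _ sC.
have [WW WE] := block_diagonalizable a VV CE.
move: (block_mx _ _ _ _) WW WE => W WW WE.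
exists (W *m H), (row_mx a%:M d); split.
  by rewrite trmx_mul HT mulmxA -[W *m H *m H]mulmxA HH mulmx1.
rewrite [LHS]AB trmx_mul HT !mulmxA; congr (_ *m _); rewrite -!mulmxA.
by congr (_ *m _); rewrite -[LHS]submxK Bl Br Bu WE mulmxA.
Qed.

End Spectral.

(** * Functional calculus *)

Section FunctionalCalculus.
Variables (R : realType) (n : nat).
Implicit Types (A B U V W : 'M[R]_n) (d e : 'rV[R]_n) (f g : R -> R).

Lemma trmx_mxdiag U d : (U^T *m diag_mx d *m U)^T = U^T *m diag_mx d *m U.
Proof. by rewrite !trmx_mul trmxK tr_diag_mx mulmxA. Qed.

Lemma mxfun_sym f A : A^T = A -> (mxfun f A)^T = mxfun f A.
Proof.
by move=> /symmetric_diagonalizable[U [d [UU ->]]]; rewrite mxfunE // trmx_mxdiag.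
Qed.

Lemma mxfun_comp f g A : A^T = A -> mxfun f (mxfun g A) = mxfun (f \o g) A.
Proof.
move=> /symmetric_diagonalizable[U [d [UU ->]]]; rewrite !mxfunE //.
by rewrite map_mx_comp.
Qed.

Lemma mxfun_mul f g A : A^T = A ->
  mxfun f A *m mxfun g A = mxfun (fun x => f x * g x) A.
Proof.
move=> /symmetric_diagonalizable[U [d [UU ->]]]; rewrite !mxfunE //.
rewrite !mulmxA -[_ *m U *m U^T]mulmxA UU mulmx1 -[_ *m diag_mx _ *m diag_mx _]mulmxA.
rewrite mulmx_diag; congr (_ *m diag_mx _ *m _).
by apply/rowP => i; rewrite !mxE.
Qed.

(* Entries of [U Z V^T] are supported where the eigenvalues agree. *)
Lemma mxfun_intertwine f A B (Z : 'M[R]_n) : A^T = A -> B^T = B ->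
  A *m Z = Z *m B -> mxfun f A *m Z = Z *m mxfun f B.
Proof.
move=> /symmetric_diagonalizable[U [d [UU ->]]].
move=> /symmetric_diagonalizable[V [e [VV ->]]] AZ.
have UU' := mulmx1C UU; have VV' := mulmx1C VV.
pose W := U *m Z *m V^T.
have ZE : Z = U^T *m W *m V.
  by rewrite /W !mulmxA UU' mul1mx -mulmxA VV' mulmx1.
have WE : diag_mx d *m W = W *m diag_mx e.
  have : U *m (U^T *m diag_mx d *m U *m Z) *m V^T =
         U *m (Z *m (V^T *m diag_mx e *m V)) *m V^T by rewrite AZ.
  rewrite !mulmxA UU mul1mx -[_ *m V *m V^T]mulmxA VV mulmx1.
  by rewrite -!mulmxA [U *m (Z *m _)]mulmxA.
rewrite !mxfunE // ZE; clearbody W.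
rewrite !mulmxA -[_ *m U *m U^T]mulmxA UU mulmx1.
rewrite -[_ *m V *m V^T]mulmxA VV mulmx1; congr (_ *m _).
rewrite -!mulmxA; congr (_ *m _).
apply/matrixP => i j; move/matrixP/(_ i j): WE.
rewrite !mul_diag_mx !mul_mx_diag ![(\matrix_(_, _) _) _ _]mxE !mxE.
have [->|w0] := eqVneq (W i j) 0; first by rewrite !(mulr0, mul0r).
by rewrite mulrC => /(mulfI w0) ->; rewrite mulrC.
Qed.

(** Squared Frobenius norm. Unlike the max norm [|A|], it is invariant under orthogonal factors. *)
Definition frob A : R := \sum_i \sum_j A i j ^+ 2.

Lemma frobE A : frob A = \tr (A *m A^T).
Proof.
by apply: eq_bigr => i _; rewrite mxE; apply: eq_bigr => j _; rewrite mxE.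
Qed.

Lemma frob_mul_orthogonal U V A : U *m U^T = 1%:M -> V *m V^T = 1%:M ->
  frob (V *m A *m U^T) = frob A.
Proof.
move=> /mulmx1C UU /mulmx1C VV; rewrite !frobE !trmx_mul trmxK !mulmxA.
rewrite -[_ *m U^T *m U]mulmxA UU mulmx1 mxtrace_mulC !mulmxA VV mul1mx.
by rewrite mxtrace_mulC mxtrace_mulC.
Qed.

Lemma frob_diag U d f : U *m U^T = 1%:M ->
  frob (mxfun f (U^T *m diag_mx d *m U)) = \sum_i f (d 0 i) ^+ 2.
Proof.
move=> UU; rewrite mxfunE // -[X in _ *m X]trmxK frob_mul_orthogonal ?trmxK //;
  try by apply: mulmx1C.
apply: eq_bigr => i _; rewrite (bigD1 i) //= big1 => [|j ji]; rewrite !mxE.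
  by rewrite eqxx mulr1n addr0.
by rewrite eq_sym (negbTE ji) mulr0n expr0n.
Qed.

Lemma mxtrace_diag U d f : U *m U^T = 1%:M ->
  \tr (mxfun f (U^T *m diag_mx d *m U)) = \sum_i f (d 0 i).
Proof.
move=> UU; rewrite mxfunE // mxtrace_mulC mulmxA UU mul1mx mxtrace_diag.
by apply: eq_bigr => i _; rewrite mxE.
Qed.

Section TwoMatrices.
Variables (U V : 'M[R]_n) (d e : 'rV[R]_n).
Hypotheses (UU : U *m U^T = 1%:M) (VV : V *m V^T = 1%:M).
Let A := U^T *m diag_mx d *m U.
Let B := V^T *m diag_mx e *m V.
Let w i j := (V *m U^T) i j ^+ 2.

Lemma weight_ge0 i j : 0 <= w i j. Proof. exact: sqr_ge0. Qed.

Lemma sum_weightl i : \sum_j w i j = 1.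
Proof.
have : (V *m U^T *m (V *m U^T)^T) i i = 1.
  by rewrite trmx_mul trmxK mulmxA -[_ *m U^T *m U]mulmxA (mulmx1C UU) mulmx1 VV mxE eqxx.
by rewrite mxE => <-; apply: eq_bigr => j _; rewrite [_^T _ _]mxE.
Qed.

Lemma sum_weightr j : \sum_i w i j = 1.
Proof.
have : ((V *m U^T)^T *m (V *m U^T)) j j = 1.
  by rewrite trmx_mul trmxK mulmxA -[_ *m V^T *m V]mulmxA (mulmx1C VV) mulmx1 UU mxE eqxx.
by rewrite mxE => <-; apply: eq_bigr => i _; rewrite [_^T _ _]mxE.
Qed.

(** Multiplying by [V] on the left and [U^T] on the right turns the difference into the matrix with
    entries (V U^T)_ij (f(e_i) - f(d_j)). *)
Lemma frob_mxfun_sub f : frob (mxfun f B - mxfun f A) =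
  \sum_i \sum_j w i j * (f (e 0 i) - f (d 0 j)) ^+ 2.
Proof.
rewrite -(frob_mul_orthogonal _ UU VV) !mxfunE // mulmxBr mulmxBl.
rewrite !mulmxA VV mul1mx -[_ *m U *m U^T]mulmxA UU mulmx1.
rewrite -[_ *m V *m U^T]mulmxA; apply: eq_bigr => i _; apply: eq_bigr => j _.
by rewrite mul_diag_mx mul_mx_diag !mxE -exprMn /w mxE; ring.
Qed.

Lemma frob_sub : frob (B - A) = \sum_i \sum_j w i j * (e 0 i - d 0 j) ^+ 2.
Proof.
have := frob_mxfun_sub id; rewrite !mxfunE //.
by rewrite !(map_mx_id (fun x => erefl)).
Qed.

(** Row sums 1 produce Tr f(B), column sums 1 produce Tr f(A), and the diagonal entries of
    [U *m B *m U^T] are the averages [\sum_i w i j * e 0 i]. *)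
Lemma mxtrace_taylor f f' :
  \tr (mxfun f B) - \tr (mxfun f A) - \tr (mxfun f' A *m (B - A)) =
  \sum_i \sum_j w i j * (f (e 0 i) - f (d 0 j) - f' (d 0 j) * (e 0 i - d 0 j)).
Proof.
have -> : \tr (mxfun f' A *m (B - A)) =
    \sum_i \sum_j w i j * (f' (d 0 j) * (e 0 i - d 0 j)).
  rewrite mxfunE // -!mulmxA mxtrace_mulC -!mulmxA.
  have -> : U *m ((B - A) *m U^T) = U *m V^T *m diag_mx e *m (V *m U^T) - diag_mx d.
    rewrite mulmxBl mulmxBr /A /B !mulmxA UU mul1mx.
    by rewrite -[diag_mx d *m U *m U^T]mulmxA UU mulmx1.
  rewrite exchange_big /=; apply: eq_bigr => j _.
  rewrite mul_diag_mx mxE [map_mx _ _ _ _]mxE [(_ - diag_mx _) _ _]mxE [(- diag_mx _) _ _]mxE [diag_mx d j j]mxE eqxx mulr1n.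
  under eq_bigr do rewrite mulrCA mulrBr.
  rewrite -mulr_sumr sumrB -mulr_suml sum_weightr mul1r.
  congr (_ * (_ - _)); rewrite [LHS]mxE; apply: eq_bigr => i _.
  have -> : U *m V^T = (V *m U^T)^T by rewrite trmx_mul trmxK.
  by rewrite mul_mx_diag !mxE /w mxE; ring.
have -> : \tr (mxfun f B) = \sum_i \sum_j w i j * f (e 0 i).
  rewrite mxtrace_diag //; apply: eq_bigr => i _.
  by rewrite -mulr_suml sum_weightl mul1r.
have -> : \tr (mxfun f A) = \sum_i \sum_j w i j * f (d 0 j).
  rewrite mxtrace_diag // exchange_big; apply: eq_bigr => j _ /=.
  by rewrite -mulr_suml sum_weightr mul1r.
rewrite -!sumrB; apply: eq_bigr => i _; rewrite -!sumrB; apply: eq_bigr => j _.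
by rewrite -!mulrBr.
Qed.

(* The weights [w i _] sum to 1, so some eigenvalue of [A] is close to [e i]. *)
Lemma eigenvalue_near eta i : 0 <= eta -> frob (B - A) <= eta ^+ 2 ->
  exists j, `|e 0 i - d 0 j| <= eta.
Proof.
move=> eta0; rewrite frob_sub => h; apply: contrapT => /forallNP far.
suff : eta ^+ 2 < \sum_j w i j * (e 0 i - d 0 j) ^+ 2.
  apply/negP; rewrite -leNgt; apply: le_trans h; rewrite [leRHS](bigD1 i) //=.
  rewrite lerDl; apply: sumr_ge0 => k _; apply: sumr_ge0 => j _.
  by rewrite mulr_ge0 ?weight_ge0 ?sqr_ge0.
rewrite -[X in X < _]mul1r -(sum_weightl i) mulr_suml -subr_gt0 -sumrB.
have far2 j : eta ^+ 2 < (e 0 i - d 0 j) ^+ 2.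
  have /negP := far j; rewrite -ltNge => ?.
  by rewrite -[X in _ < X]real_normK ?num_real // ltr_pXn2r ?nnegrE.
have h0 j : 0 <= w i j * (e 0 i - d 0 j) ^+ 2 - w i j * eta ^+ 2.
  by rewrite -mulrBr mulr_ge0 ?weight_ge0 // subr_ge0 ltW.
(* Equality would make every weight of row [i] vanish, against their sum being 1. *)
rewrite lt_neqAle sumr_ge0 ?andbT // eq_sym psumr_eq0 //.
apply/negP => /allP z; have := sum_weightl i.
rewrite big1 => [/eqP|j _]; first by rewrite eq_sym oner_eq0.
have := z j (mem_index_enum _); rewrite /= -mulrBr mulf_eq0.
by rewrite [X in _ || X]gt_eqF ?subr_gt0 // orbF => /eqP.
Qed.

End TwoMatrices.

Lemma frob_ge0 A : 0 <= frob A.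
Proof. by apply: sumr_ge0 => i _; apply: sumr_ge0 => j _; exact: sqr_ge0. Qed.

(** The Frobenius bound [b] confines both spectra to [-b, b], where the scalar estimate applies to
    every term of the weighted sum. *)
Lemma frob_mxfun_lipschitz f (C b : R) A B : 0 <= C -> A^T = A -> B^T = B ->
  frob A <= b ^+ 2 -> frob B <= b ^+ 2 -> 0 <= b ->
  (forall x y, `|x| <= b -> `|y| <= b -> `|f x - f y| <= C * `|x - y|) ->
  frob (mxfun f B - mxfun f A) <= C ^+ 2 * frob (B - A).
Proof.
move=> C0 /symmetric_diagonalizable[U [d [UU AE]]].
move=> /symmetric_diagonalizable[V [e [VV BE]]] hA hB b0 hf.
have bound W c : W *m W^T = 1%:M -> frob (W^T *m diag_mx c *m W) <= b ^+ 2 ->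
    forall i, `|c 0 i| <= b.
  move=> WW; have := frob_diag c id WW; rewrite mxfunE // map_mx_id // => -> h i.
  rewrite -(ler_pXn2r (n := 2)) ?nnegrE // real_normK ?num_real //.
  apply: le_trans h; rewrite (bigD1 i) //= lerDl.
  by apply: sumr_ge0 => j _; exact: sqr_ge0.
have hd := bound U d UU; have he := bound V e VV.
rewrite -AE in hd; rewrite -BE in he.
rewrite AE BE frob_mxfun_sub // frob_sub //.
rewrite mulr_sumr ler_sum // => i _; rewrite mulr_sumr ler_sum // => j _.
rewrite [leRHS]mulrCA ler_wpM2l ?sqr_ge0 // -exprMn.
rewrite -[leLHS]real_normK ?num_real // -[leRHS]real_normK ?num_real //.
rewrite ler_pXn2r ?nnegrE // normrM (ger0_norm C0).
exact: hf (he hB _) (hd hA _).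
Qed.

End FunctionalCalculus.

(** * Positive definite matrices *)

Section RealEstimates.
Variable R : realType.

Lemma expR_lipschitz (b x y : R) : `|x| <= b -> `|y| <= b ->
  `|expR x - expR y| <= expR b * `|x - y|.
Proof.
wlog xy : x y / x <= y.
  move=> h; have [/h//|/ltW yx] := leP x y.
  by move=> hx hy; rewrite distrC [X in _ * X]distrC; exact: h.
move=> _ /ler_normlP[_ yb].
rewrite distrC [X in _ * X]distrC !ger0_norm ?subr_ge0 ?ler_expR //.
have -> : expR y - expR x = expR y * (1 - expR (x - y)).
  by rewrite mulrBr mulr1 -expRD subrKC.
apply: ler_pM; rewrite ?expR_ge0 ?ler_expR ?subr_ge0 //.
  by rewrite expR_le1 subr_le0.
by have := expR_ge1Dx (x - y); lra.
Qed.

Lemma ln_bounds (x : R) : 0 < x -> (x - 1) / x <= ln x <= x - 1.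
Proof.
move=> x0; have ub z : 0 < z -> ln z <= z - 1 :> R.
  by move=> z0; have := @le_ln1Dx R (z - 1); rewrite subrKC; apply; lra.
rewrite ub // andbT mulrBl mulfV ?gt_eqF // mul1r.
have := ub x^-1; rewrite invr_gt0 lnV ?posrE // => /(_ x0); lra.
Qed.

(** With x = e / d, t = ln x and u = x - 1 the remainder is t^2 + 2 ln d (t - u), where u / x <= t
    <= u and 1 / x <= d / a. The bound covers all [e] from [a] on, not only those near [d], because
    the weighted sum pairs every eigenvalue of one matrix with every eigenvalue of the other. *)
Lemma ln_sqr_taylor (a d : R) : 0 < a -> 0 < d ->
  exists2 C, 0 <= C & forall e, a <= e ->
  `|ln e ^+ 2 - ln d ^+ 2 - 2 * ln d / d * (e - d)| <= C * (e - d) ^+ 2.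
Proof.
move=> a0 d0; pose k := d / a.
have k0 : 0 <= k by rewrite divr_ge0 // ltW.
exists ((1 + k ^+ 2 + `|2 * ln d| * k) / d ^+ 2).
  apply: divr_ge0; last exact: sqr_ge0.
  by apply: addr_ge0; [apply: addr_ge0; rewrite ?sqr_ge0 | exact: mulr_ge0].
move=> e ae; have e0 : 0 < e by apply: lt_le_trans ae.
pose x := e / d; have x0 : 0 < x by rewrite divr_gt0.
have xk : x^-1 <= k by rewrite /x /k invf_div ler_pM2l // lef_pV2.
have [lo hi] := andP (ln_bounds x0).
have lnx : ln x = ln e - ln d by rewrite ln_div.
have ex : e = d * x by rewrite /x mulrC divfK ?gt_eqF.
set t := ln x in lnx lo hi; set u := x - 1 in hi lo.
have -> : ln e ^+ 2 - ln d ^+ 2 - 2 * ln d / d * (e - d) = t ^+ 2 + 2 * ln d * (t - u).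
  by rewrite lnx /u ex; field; rewrite gt_eqF.
have -> : (1 + k ^+ 2 + `|2 * ln d| * k) / d ^+ 2 * (e - d) ^+ 2 =
    (1 + k ^+ 2) * u ^+ 2 + `|2 * ln d| * (k * u ^+ 2).
  by rewrite /u ex; field; rewrite gt_eqF.
have lo' : u / x = u - u ^+ 2 / x by rewrite /u; field; rewrite gt_eqF.
have ux : u ^+ 2 / x <= k * u ^+ 2 by rewrite mulrC ler_wpM2r ?sqr_ge0.
apply: le_trans (ler_normD _ _) _; apply: lerD; last first.
  rewrite normrM; apply: ler_wpM2l => //.
  by rewrite distrC ger0_norm ?subr_ge0 //; lra.
rewrite ger0_norm ?sqr_ge0 // mulrDl mul1r.
have [t0|t0] := leP 0 t.
  have : t ^+ 2 <= u ^+ 2 by rewrite ler_pXn2r ?nnegrE //; lra.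
  have := mulr_ge0 (sqr_ge0 k) (sqr_ge0 u); lra.
(* For negative [t] it is the lower bound u / x <= t that controls |t|, by k |u|; hence the [k ^+ 2]
   in the constant. *)
have u0 : u < 0.
  have := le_lt_trans lo t0; rewrite pmulr_llt0 // invr_gt0 //.
have tku : - t <= k * - u.
  have : x^-1 * - u <= k * - u by apply: ler_wpM2r => //; lra.
  lra.
have ku : 0 <= k * - u by rewrite mulr_ge0 //; lra.
have : (- t) ^+ 2 <= (k * - u) ^+ 2 by rewrite ler_pXn2r ?nnegrE //; lra.
rewrite sqrrN exprMn sqrrN; have := sqr_ge0 u; lra.
Qed.

End RealEstimates.

(** * Square roots, logarithms and whitening of positive definite matrices *)

Section PositiveDefinite.
Variables (R : realType) (n : nat).
Implicit Types (A P Q S : 'M[R]_n).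

(** Counterpart of [SPD] for plain matrices, whose type does not record symmetry. *)
Definition posdef A := A^T = A /\
  forall v : 'cV[R]_n, v != 0 -> 0 < (v^T *m A *m v) 0 0.

Lemma posdef_diag A : posdef A -> exists (U : 'M[R]_n) (d : 'rV[R]_n),
  [/\ U *m U^T = 1%:M, A = U^T *m diag_mx d *m U & forall i, 0 < d 0 i].
Proof.
move=> [sA h]; have [U [d [UU AE]]] := symmetric_diagonalizable sA.
exists U, d; split=> // i; pose v : 'cV[R]_n := U^T *m delta_mx i 0.
have Uv : U *m v = delta_mx i 0 by rewrite /v mulmxA UU mul1mx.
have v0 : v != 0.
  apply/eqP => v0; move: Uv; rewrite v0 mulmx0 => /colP/(_ i).
  by rewrite !mxE !eqxx => /eqP; rewrite eq_sym oner_eq0.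
have := h _ v0.
have -> : v^T *m A *m v = (U *m v)^T *m diag_mx d *m (U *m v).
  by rewrite AE [(U *m v)^T]trmx_mul !mulmxA.
rewrite Uv trmx_delta mul_mx_diag mxE (bigD1 i) //= big1 => [|j ji].
  by rewrite !mxE !eqxx mul1r mulr1 addr0.
by rewrite !mxE (negbTE ji) andbF !mul0r.
Qed.

(** The spectrum is positive, so scalar identities such as exp (ln x) = x are only required where
    they hold. *)
Lemma eq_mxfun_pos (f g : R -> R) A : posdef A -> (forall x, 0 < x -> f x = g x) ->
  mxfun f A = mxfun g A.
Proof.
move=> /posdef_diag[U [d [UU -> d0]]] fg; rewrite !mxfunE //.
congr (_ *m diag_mx _ *m _); apply/rowP => i; rewrite !mxE; exact: fg.
Qed.

Lemma mxfun_id A : A^T = A -> mxfun id A = A.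
Proof.
move=> /symmetric_diagonalizable[U [d [UU ->]]]; rewrite mxfunE //.
by rewrite map_mx_id.
Qed.

Lemma mxfun_1 A : A^T = A -> mxfun (fun=> 1) A = 1%:M.
Proof.
move=> /symmetric_diagonalizable[U [d [UU ->]]]; rewrite mxfunE //.
have -> : map_mx (fun=> 1) d = const_mx 1 :> 'rV[R]_n by apply/rowP => i; rewrite !mxE.
by rewrite diag_const_mx mulmx1 (mulmx1C UU).
Qed.

Lemma mxsqrt_sym P : posdef P -> (mxsqrt P)^T = mxsqrt P.
Proof. by move=> [sP _]; exact: mxfun_sym. Qed.

Lemma mxsqrt_sqr P : posdef P -> mxsqrt P *m mxsqrt P = P.
Proof.
move=> pP; have [sP _] := pP; rewrite /mxsqrt mxfun_mul //.
rewrite (eq_mxfun_pos (g := id) pP) ?mxfun_id // => x x0.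
by rewrite -expr2 sqr_sqrtr // ltW.
Qed.

Lemma posdef_mulV P : posdef P -> mxfun GRing.inv P *m P = 1%:M.
Proof.
move=> pP; have [sP _] := pP; rewrite -{2}(mxfun_id sP) mxfun_mul //.
rewrite (eq_mxfun_pos (g := fun=> 1) pP) ?mxfun_1 // => x x0.
by rewrite mulVf // gt_eqF.
Qed.

Lemma posdef_unit P : posdef P -> P \in unitmx.
Proof. by move=> /posdef_mulV /mulmx1_unit[]. Qed.

Lemma mxsqrt_unit P : posdef P -> mxsqrt P \in unitmx.
Proof.
move=> pP; have := posdef_unit pP; rewrite -{1}(mxsqrt_sqr pP).
by rewrite unitmx_mul andbb.
Qed.

Lemma invmx_sqrt_sym P : posdef P -> (invmx (mxsqrt P))^T = invmx (mxsqrt P).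
Proof. by move=> pP; rewrite trmx_inv mxsqrt_sym. Qed.

Lemma whiten_sym P Q : posdef P -> Q^T = Q -> (whiten P Q)^T = whiten P Q.
Proof. by move=> pP sQ; rewrite /whiten !trmx_mul invmx_sqrt_sym // sQ mulmxA. Qed.

Lemma posdef_whiten P Q : posdef P -> posdef Q -> posdef (whiten P Q).
Proof.
move=> pP [sQ pQ]; split=> [|v v0]; first exact: whiten_sym.
have -> : v^T *m whiten P Q *m v =
    (invmx (mxsqrt P) *m v)^T *m Q *m (invmx (mxsqrt P) *m v).
  by rewrite /whiten trmx_mul invmx_sqrt_sym // !mulmxA.
apply: pQ; apply: contra_neq v0 => h.
by rewrite -[v]mul1mx -(mulmxV (mxsqrt_unit pP)) -mulmxA h mulmx0.
Qed.

Lemma mxsqrt_whiten P Q : posdef P -> mxsqrt P *m whiten P Q *m mxsqrt P = Q.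
Proof.
move=> /mxsqrt_unit u; rewrite /whiten !mulmxA mulmxV // mul1mx.
by rewrite -mulmxA mulVmx // mulmx1.
Qed.

Lemma mxlog_sym A : A^T = A -> (mxlog A)^T = mxlog A.
Proof. exact: mxfun_sym. Qed.

Lemma mxfun_expR_log A : posdef A -> mxfun expR (mxlog A) = A.
Proof.
move=> pA; have [sA _] := pA; rewrite /mxlog mxfun_comp //.
rewrite (eq_mxfun_pos (g := id) pA) ?mxfun_id // => x x0.
by rewrite /= lnK.
Qed.

Lemma spd_log_sym P Q : posdef P -> Q^T = Q -> (spd_log P Q)^T = spd_log P Q.
Proof.
move=> pP sQ; rewrite /spd_log !trmx_mul mxsqrt_sym // mxlog_sym ?mulmxA //.
exact: whiten_sym.
Qed.

(* With [Y = Q^-1/2 P^1/2] one has [whiten Q P = Y Y^T] and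
   [(whiten P Q)^-1 = Y^T Y = Y^-1 (whiten Q P) Y], so the two logarithms are
   conjugate up to sign. *)
Lemma gradient_spd_log P Q : posdef P -> posdef Q ->
  let Qi := invmx (mxsqrt Q) in
  Qi *m mxfun (fun x => 2 * ln x / x) (whiten Q P) *m Qi =
  - (2 *: (invmx P *m spd_log P Q *m invmx P)).
Proof.
move=> pP pQ Qi.
set S := mxsqrt Q in Qi *; set T := mxsqrt P.
have uS : S \in unitmx := mxsqrt_unit pQ; have uT : T \in unitmx := mxsqrt_unit pP.
have SS : S *m S = Q := mxsqrt_sqr pQ; have TT : T *m T = P := mxsqrt_sqr pP.
pose Ti := invmx T; pose A := whiten Q P; pose M := whiten P Q.
have pA : posdef A := posdef_whiten pQ pP; have [sA _] := pA.
have pM : posdef M := posdef_whiten pP pQ; have [sM _] := pM.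
have QiS : Qi *m S = 1%:M by rewrite mulVmx.
have SQi : S *m Qi = 1%:M by rewrite mulmxV.
have TiT : Ti *m T = 1%:M by rewrite mulVmx.
have TTi : T *m Ti = 1%:M by rewrite mulmxV.
have Pi : invmx P = Ti *m Ti.
  have h : P *m (Ti *m Ti) = 1%:M by rewrite -TT -mulmxA (mulmxA T Ti) TTi mul1mx TTi.
  by rewrite -[RHS]mul1mx -(mulVmx (posdef_unit pP)) -mulmxA h mulmx1.
pose N := mxfun GRing.inv A.
have NA : N *m A = 1%:M := posdef_mulV pA.
have sN : N^T = N by exact: mxfun_sym.
have NE : N = S *m Ti *m Ti *m S.
  have h : A *m (S *m Ti *m Ti *m S) = 1%:M.
    rewrite /A /whiten -/S -/Qi -TT !mulmxA -[_ *m Qi *m S]mulmxA QiS mulmx1.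
    rewrite -[_ *m T *m Ti]mulmxA TTi mulmx1 -[_ *m T *m Ti]mulmxA TTi mulmx1.
    by [].
  by rewrite -[RHS]mul1mx -NA -mulmxA h mulmx1.
(* The conjugating matrix [Qi *m T] is not orthogonal in general, so the logarithm passes through it
   by [mxfun_intertwine]. *)
have inter : N *m (Qi *m T) = (Qi *m T) *m M.
  rewrite NE /M /whiten -/T -/Ti -SS !mulmxA.
  rewrite -[_ *m S *m Qi]mulmxA SQi mulmx1 -[_ *m Ti *m T]mulmxA TiT mulmx1.
  by rewrite -[_ *m T *m Ti]mulmxA TTi mulmx1 QiS mul1mx.
have logN : mxlog N = - mxlog A.
  rewrite /mxlog /N mxfun_comp // -scaleN1r.
  have -> : -1 *: mxfun (@ln R) A = mxfun (fun x => - ln x) A.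
    have [U [d [UU -> d0]]] := posdef_diag pA; rewrite !mxfunE //.
    rewrite scalemxAl scalemxAr -linearZ /=; congr (_ *m diag_mx _ *m _).
    by apply/rowP => i; rewrite !mxE mulN1r.
  by apply: eq_mxfun_pos => // x x0; rewrite /= lnV.
have := mxfun_intertwine (@ln R) sN sM inter; rewrite -!/(mxlog _) logN => LE.
have fE : mxfun (fun x => 2 * ln x / x) A = 2 *: (N *m mxlog A).
  rewrite /N /mxlog mxfun_mul //.
  have [U [d [UU -> d0]]] := posdef_diag pA; rewrite !mxfunE //.
  rewrite scalemxAl scalemxAr -linearZ /=; congr (_ *m diag_mx _ *m _).
  by apply/rowP => i; rewrite !mxE mulrA [in RHS]mulrC mulrCA mulrA mulrC mulrA.
rewrite -/A fE -scalemxAr -scalemxAl -scalerN; congr (_ *: _).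
rewrite /spd_log -/M -/T Pi.
have -> : Ti *m Ti *m (T *m mxlog M *m T) *m (Ti *m Ti) = Ti *m mxlog M *m Ti.
  rewrite !mulmxA -[_ *m Ti *m T]mulmxA TiT mulmx1.
  by rewrite -[_ *m T *m Ti]mulmxA TTi mulmx1.
have -> : mxlog M = - (Ti *m S *m mxlog A *m Qi *m T).
  have : Ti *m S *m (Qi *m T *m mxlog M) = mxlog M.
    by rewrite !mulmxA -[_ *m S *m Qi]mulmxA SQi mulmx1 TiT mul1mx.
  by move=> <-; rewrite -LE !mulNmx !mulmxN !mulmxA.
rewrite mulmxN mulNmx opprK NE !mulmxA QiS mul1mx.
by rewrite -[_ *m T *m Ti]mulmxA TTi mulmx1.
Qed.

End PositiveDefinite.

(** * Differential of the squared distances *)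

Section Differential.
Variable R : realType.

Lemma mx_norm_le_coef m n (A : 'M[R]_(m, n)) i j : `|A i j| <= `|A|.
Proof.
rewrite [leRHS]mx_normrE.
exact: (le_bigmax 0 (fun p : 'I_m * 'I_n => `|A p.1 p.2|) (i, j)).
Qed.

Lemma mx_norm_le m n (A : 'M[R]_(m, n)) (b : R) : 0 <= b ->
  (forall i j, `|A i j| <= b) -> `|A| <= b.
Proof. by move=> b0 h; rewrite [leLHS]mx_normrE; apply: bigmax_le. Qed.

(** A remainder of order |h|^2 is o(h), and the bound by [K] gives the continuity of [D] that a
    differential must have. *)
Lemma differentiable_quadratic (V W : normedModType R) (f : V -> W)
    (D : {linear V -> W}) (x : V) (C K delta : R) : 0 < delta -> 0 <= C ->
  (forall h, `|D h| <= K * `|h|) ->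
  (forall h, `|h| <= delta -> `|f (h + x) - f x - D h| <= C * `|h| ^+ 2) ->
  differentiable f x /\ 'd f x = D :> (V -> W).
Proof.
move=> delta0 C0 DK Df.
have Dc : continuous D.
  apply/linear_bounded_continuous/linear_boundedP.
  apply: filterS (nbhs_pinfty_ge (num_real K)) => r Kr h.
  by apply: le_trans (DK h) _; exact: ler_wpM2r.
have fD : f \o shift x = cst (f x) + D +o_ 0 id.
  apply/eqaddoP => e e0.
  have d0 : 0 < Num.min delta (e / (C + 1)).
    by rewrite lt_min delta0 divr_gt0 // ltr_wpDl.
  near=> h.
  have hd : `|h| <= Num.min delta (e / (C + 1)).
    by near: h; apply/nbhs_norm0P; exists (Num.min delta (e / (C + 1))) => //= h /ltW.
  move: hd; rewrite le_min => /andP[h1 h2].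
  have -> : (f \o shift x - (cst (f x) + D)) h = f (h + x) - f x - D h.
    by rewrite -[LHS]/(f (h + x) - (f x + D h)) opprD addrA.
  apply: le_trans (Df h h1) _.
  rewrite expr2 mulrA; apply: ler_wpM2r => //.
  move: h2; rewrite ler_pdivlMr ?ltr_wpDl // => h2.
  apply: le_trans h2; rewrite mulrC mulrDr mulr1 lerDl; exact: normr_ge0.
have dE : 'd f x = D :> (V -> W) by apply: diff_unique.
by split=> //; apply/diff_locallyP; rewrite dE.
Unshelve. all: by end_near. Qed.

Section TraceForm.
Variables (n l : nat) (G : 'I_l -> 'M[R]_n).

(** The candidate differential of [sqdist_map], with the gradients as [G]. *)
Definition trace_form (V : Sym R n) : 'rV[R]_l := \row_i \tr (G i *m sym_mx V).

Fact trace_form_linear : linear trace_form.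
Proof.
move=> a u v; apply/rowP => i; rewrite !mxE /= mulmxDr mxtraceD.
by rewrite -scalemxAr mxtraceZ.
Qed.

HB.instance Definition _ :=
  GRing.isLinear.Build R (Sym R n) 'rV[R]_l _ trace_form trace_form_linear.

End TraceForm.

Lemma linear_formP (V : lmodType R) (phi : V -> R) : linear_for *%R phi ->
  [/\ phi 0 = 0, {morph phi : u v / u + v} & forall a u, phi (a *: u) = a * phi u].
Proof.
move=> lin; have phi0 : phi 0 = 0.
  by have := lin (-1) 0 0; rewrite scaler0 addr0 mulN1r addNr.
split=> // [u v|a u]; first by have := lin 1 u v; rewrite scale1r mul1r.
by have := lin a u 0; rewrite phi0 !addr0.
Qed.

Lemma linear_form_bounded n (phi : 'M[R]_n -> R) : linear_for *%R phi ->
  exists2 K, 0 <= K & forall V, `|phi V| <= K * `|V|.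
Proof.
move=> /linear_formP[phi0 phiD phiZ].
exists (\sum_i \sum_j `|phi (delta_mx i j)|).
  by apply: sumr_ge0 => i _; apply: sumr_ge0.
move=> V; rewrite {1}[V]matrix_sum_delta (big_morph phi phiD phi0) mulr_suml.
apply: le_trans (ler_norm_sum _ _ _) _; apply: ler_sum => i _.
rewrite (big_morph phi phiD phi0) mulr_suml.
apply: le_trans (ler_norm_sum _ _ _) _; apply: ler_sum => j _.
by rewrite phiZ normrM mulrC ler_wpM2l // mx_norm_le_coef.
Qed.

Lemma frob_congr_bounded n (S : 'M[R]_n) :
  exists2 K, 0 <= K & forall V, frob (S *m V *m S) <= K * `|V| ^+ 2.
Proof.
have h i : exists c : 'I_n -> R, (forall j, 0 <= c j) /\
    forall j V, `|(S *m V *m S) i j| <= c j * `|V|.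
  have /choice[c hc] : forall j, exists K, 0 <= K /\ forall V, `|(S *m V *m S) i j| <= K * `|V|.
    move=> j; have [|K K0 hK] := @linear_form_bounded n (fun V => (S *m V *m S) i j).
      by move=> a u v; rewrite mulmxDr mulmxDl -scalemxAr -scalemxAl !mxE.
    by exists K.
  by exists c; split=> j; have [] := hc j.
have /choice[c hc] := h.
exists (\sum_i \sum_j c i j ^+ 2).
  by apply: sumr_ge0 => i _; apply: sumr_ge0 => j _; exact: sqr_ge0.
move=> V; rewrite mulr_suml; apply: ler_sum => i _; rewrite mulr_suml.
apply: ler_sum => j _; have [c0 cV] := hc i.
rewrite -exprMn -[leLHS]real_normK ?num_real //.
by rewrite ler_pXn2r ?nnegrE ?mulr_ge0.
Qed.

Lemma mxtrace_ln_sqr_taylor n (A : 'M[R]_n) : posdef A ->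
  exists C a, [/\ 0 <= C, 0 < a & forall B, B^T = B -> frob (B - A) <= a ^+ 2 ->
   `|\tr (mxfun (fun x => ln x ^+ 2) B) - \tr (mxfun (fun x => ln x ^+ 2) A) -
     \tr (mxfun (fun x => 2 * ln x / x) A *m (B - A))| <= C * frob (B - A)].
Proof.
move=> /posdef_diag[U [d [UU AE d0]]].
(* At most half the least eigenvalue of [A]: by [eigenvalue_near], every eigenvalue of a [B] within
   [a] of [A] is at least 2a - a = a. *)
pose a := \big[Num.min/1]_i (d 0 i) / 2.
have a0 : 0 < a by rewrite divr_gt0 // lt_bigmin.
have ad i : 2 * a <= d 0 i by rewrite /a mulrC divfK //; exact: bigmin_le.
have /choice[c hc] : forall j, exists C, 0 <= C /\ forall e, a <= e ->
    `|ln e ^+ 2 - ln (d 0 j) ^+ 2 - 2 * ln (d 0 j) / d 0 j * (e - d 0 j)|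
    <= C * (e - d 0 j) ^+ 2.
  by move=> j; have [C C0 hC] := ln_sqr_taylor a0 (d0 j); exists C.
have c0 j : 0 <= c j by have [] := hc j.
exists (\sum_j c j), a; split=> //; first exact: sumr_ge0.
move=> B /symmetric_diagonalizable[V [e [VV BE]]]; rewrite {}AE {}BE => near.
have ae i : a <= e 0 i.
  have [j] := eigenvalue_near UU VV i (ltW a0) near.
  by move=> /ler_normlP[h1 _]; have := ad j; lra.
rewrite mxtrace_taylor // frob_sub // mulr_sumr.
apply: le_trans (ler_norm_sum _ _ _) _; apply: ler_sum => i _; rewrite mulr_sumr.
apply: le_trans (ler_norm_sum _ _ _) _; apply: ler_sum => j _.
rewrite normrM ger0_norm ?sqr_ge0 // [leRHS]mulrCA; apply: ler_wpM2l.
  exact: sqr_ge0.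
have [_ /(_ (e 0 i) (ae i)) /le_trans] := hc j; apply.
apply: ler_wpM2r; first exact: sqr_ge0.
by rewrite (bigD1 j) //= lerDl sumr_ge0.
Qed.

Lemma SPD_posdef n (P : Sym R n) : SPD P -> posdef (sym_mx P).
Proof. by move=> h; split; [exact: tr_sym | exact: h]. Qed.

Lemma spd_dist_sqr n (Q P : 'M[R]_n) : posdef Q -> P^T = P ->
  spd_dist Q P ^+ 2 = \tr (mxfun (fun x => ln x ^+ 2) (whiten Q P)).
Proof.
move=> pQ sP; have sW := whiten_sym pQ sP.
rewrite /spd_dist sqr_sqrtr; last first.
  by rewrite -{2}(mxlog_sym sW) -frobE frob_ge0.
by rewrite /mxlog mxfun_mul.
Qed.

(** Whitening by the fixed matrix [Rs i] is linear in the moving point, so only the trace of ln^2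
    has to be expanded; [gradient_spd_log] then rewrites the gradient in terms of [spd_log]. *)
Lemma sqdist_differentiable n l (Rs : 'I_l -> Sym R n) (P : Sym R n) :
  (forall i, SPD (Rs i)) -> SPD P ->
  differentiable (sqdist_map Rs) P /\
  forall V, 'd (sqdist_map Rs) P V =
    \row_i - (2 * \tr (invmx P *m spd_log P (Rs i) *m invmx P *m V)).
Proof.
move=> pRs pP; have pQ i := SPD_posdef (pRs i); have pPm := SPD_posdef pP.
pose Si i := invmx (mxsqrt (Rs i)).
pose G i := Si i *m mxfun (fun x => 2 * ln x / x) (whiten (Rs i) P) *m Si i.
have /choice[K hK] : forall i, exists K, 0 <= K /\
    forall V, `|\tr (G i *m V)| <= K * `|V|.
  move=> i; have [|K K0 h] := @linear_form_bounded n (fun V => \tr (G i *m V)).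
    by move=> a u v; rewrite mulmxDr mxtraceD -scalemxAr mxtraceZ.
  by exists K.
have /choice[CD hCD] : forall i, exists CD : R * R, [/\ 0 <= CD.1, 0 < CD.2 &
    forall V : Sym R n, `|V| <= CD.2 ->
    `|spd_dist (Rs i) (V + P) ^+ 2 - spd_dist (Rs i) P ^+ 2 - \tr (G i *m V)|
    <= CD.1 * `|V| ^+ 2].
  move=> i; have [C [a [C0 a0 h]]] := mxtrace_ln_sqr_taylor (posdef_whiten (pQ i) pPm).
  have [k k0 hk] := frob_congr_bounded (Si i).
  (* The radius ensures frob(S V S) <= k |V|^2 <= ((k + 1) |V|)^2 <= a^2; the added 1 also keeps the
     denominator nonzero. *)
  exists (C * k, a / (k + 1)) => /=; split; first exact: mulr_ge0.
    by rewrite divr_gt0 // ltr_wpDl.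
  move=> V Va.
  have WB : whiten (Rs i) (V + P) - whiten (Rs i) P = Si i *m V *m Si i.
    by rewrite /whiten mulmxDr mulmxDl addrK.
  have sVP : (sym_mx V + sym_mx P)^T = sym_mx V + sym_mx P.
    by rewrite linearD /= !tr_sym.
  have := h (whiten (Rs i) (V + P)) (whiten_sym (pQ i) sVP).
  rewrite !spd_dist_sqr // ?tr_sym // WB.
  have -> : \tr (mxfun (fun x => 2 * ln x / x) (whiten (Rs i) P) *m (Si i *m V *m Si i))
      = \tr (G i *m V).
    by rewrite /G !mulmxA mxtrace_mulC !mulmxA.
  have fV := hk V.
  have fV2 : frob (Si i *m V *m Si i) <= a ^+ 2.
    apply: le_trans fV _; rewrite ler_pdivlMr ?ltr_wpDl // in Va.
    have : (`|V| * (k + 1)) ^+ 2 <= a ^+ 2.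
      by rewrite ler_pXn2r ?nnegrE ?mulr_ge0 ?addr_ge0 // ltW.
    apply: le_trans; rewrite exprMn mulrC; apply: ler_wpM2l; first exact: sqr_ge0.
    by rewrite sqrrD1; have := sqr_ge0 k; lra.
  move=> /(_ fV2) /le_trans; apply; rewrite -mulrA; exact: ler_wpM2l.
pose D := trace_form G.
(* In the max norm on rows, sums of the coordinate constants and the least of the radii serve all
   coordinates at once. *)
pose C := \sum_i (CD i).1; pose k := \sum_i K i.
pose delta := \big[Num.min/1]_i (CD i).2.
have C0 : 0 <= C by apply: sumr_ge0 => i _; have [] := hCD i.
have k0 : 0 <= k by apply: sumr_ge0 => i _; have [] := hK i.
have le_sum (F : 'I_l -> R) i : (forall i, 0 <= F i) -> F i <= \sum_j F j.
  by move=> F0; rewrite (bigD1 i) //= lerDl sumr_ge0.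
have [|//|V|V Vd|dF dE] := @differentiable_quadratic _ _ (sqdist_map Rs)
  (trace_form G) P C k delta.
- by apply: lt_bigmin => // i _; have [] := hCD i.
- apply: mx_norm_le => [|i j]; first exact: mulr_ge0.
  rewrite mxE; have [_ h] := hK j; apply: le_trans (h V) _.
  by apply: ler_wpM2r => //; apply: le_sum => m; have [] := hK m.
- apply: mx_norm_le => [|i j]; first by rewrite mulr_ge0 ?sqr_ge0.
  rewrite !mxE; have [_ _ h] := hCD j.
  have /h /le_trans : `|V| <= (CD j).2 by apply: le_trans Vd _; exact: bigmin_le.
  apply; apply: ler_wpM2r; first exact: sqr_ge0.
  by apply: (le_sum (fun j => (CD j).1)) => m; have [] := hCD m.
split=> // V; rewrite dE; apply/rowP => i; rewrite !mxE /G /Si.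
by rewrite gradient_spd_log // mulNmx -scalemxAl linearN /= mxtraceZ.
Qed.

End Differential.

(** * Null sets *)

Section NullSets.
Variables (R : realType) (I : finType).
Implicit Types (A : set (I -> R)) (a b : nat -> I -> R).

Definition box_cover A (eps : R) a b :=
  [/\ forall k i, a k i <= b k i, A `<=` \bigcup_k box (a k) (b k) &
      (\sum_(0 <= k <oo) (\prod_i (b k i - a k i))%:E <= eps%:E)%E].

Lemma box_volume_ge0 (a b : I -> R) : (forall i, a i <= b i) ->
  (0 <= (\prod_i (b i - a i))%:E)%E.
Proof. by move=> ab; rewrite lee_fin prodr_ge0 // => i _; rewrite subr_ge0. Qed.

Lemma lebesgue_nullP A :
  lebesgue_null A <-> forall eps, 0 < eps -> exists a b, box_cover A eps a b.
Proof.
split=> [A0 eps eps0|h].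
  have : (lebesgue_outer A < eps%:E)%E by rewrite A0 lte_fin.
  by move=> /ereal_inf_lt[_ [a [b [ab Aab ->]]] /ltW sab]; exists a, b.
apply/eqP; rewrite eq_le; apply/andP; split.
  apply/lee_addgt0Pr => e e0; rewrite add0e; have [a [b [ab Aab sab]]] := h e e0.
  by apply: ge_ereal_inf; eexists; last exact: sab; exists a, b.
apply: le_ereal_inf_tmp => _ [a [b [ab _ ->]]].
by apply: nneseries_ge0 => k _ _; exact: box_volume_ge0.
Qed.

Lemma sub_lebesgue_null A B : A `<=` B -> lebesgue_null B -> lebesgue_null A.
Proof.
move=> AB /lebesgue_nullP B0; apply/lebesgue_nullP => e /B0[a [b [ab Bab sab]]].
by exists a, b; split=> //; exact: subset_trans Bab.
Qed.

(** The k-th set gets the budget e / 2^(k+1), and a bijection between [nat] and [nat * nat] merges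
    the covers into one sequence; the volumes are nonnegative, so their sum may be rearranged. *)
Lemma lebesgue_null_bigcup (F : nat -> set (I -> R)) :
  (forall k, lebesgue_null (F k)) -> lebesgue_null (\bigcup_k F k).
Proof.
move=> F0; apply/lebesgue_nullP => e e0.
have /choice[ab hab] : forall k, exists ab : (nat -> I -> R) * (nat -> I -> R),
    box_cover (F k) (e / (2 ^ k.+1)%:R) ab.1 ab.2.
  move=> k; have /lebesgue_nullP/(_ (e / (2 ^ k.+1)%:R)) := F0 k.
  case=> [|a [b hab]]; first by rewrite divr_gt0 // ltr0n expn_gt0.
  by exists (a, b).
have /card_esym/ppcard_eqP[f] := card_nat2.
pose a k j := (ab k).1 j; pose b k j := (ab k).2 j.
have vol0 k j : (0 <= (\prod_i (b k j i - a k j i))%:E)%E.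
  by apply: box_volume_ge0 => i; have [h _ _] := hab k; exact: h.
exists (fun m => a (f m).1 (f m).2), (fun m => b (f m).1 (f m).2); split.
- by move=> m i; have [h _ _] := hab (f m).1; exact: h.
- move=> x [k _ Fx]; have [_ h _] := hab k; have [j _ xj] := h x Fx.
  by exists (f^-1%FUN (k, j)) => //; rewrite invK ?inE.
- rewrite nneseries_esumT //.
  rewrite -(@reindex_esum R _ _ [set: nat] [set: nat * nat] f
     (fun p => (\prod_i (b p.1 p.2 i - a p.1 p.2 i))%:E)) //.
  have -> : [set: nat * nat] = [set: nat] `*`` (fun=> [set: nat]) by apply/seteqP; split.
  rewrite -(@esum_esum R _ _ _ _ (fun k j => (\prod_i (b k j i - a k j i))%:E)) //.
  apply: le_trans (epsilon_trick0 xpredT (ltW e0)).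
  rewrite -nneseries_esumT => [|k]; last by apply: esum_ge0.
  apply: lee_nneseries => [k _ _|k _]; first by apply: esum_ge0.
  by rewrite -nneseries_esumT //; have [_ _] := hab k.
Qed.

(** The family is padded with one-point boxes. Their volume is 0 because [I] is inhabited; an empty
    product would be 1. *)
Lemma finite_box_cover A (J : finType) (a b : J -> I -> R) (eps : R) : I ->
  (forall j i, a j i <= b j i) -> A `<=` \bigcup_j box (a j) (b j) ->
  \sum_j \prod_i (b j i - a j i) <= eps -> exists a' b', box_cover A eps a' b'.
Proof.
move=> i0 ab Aab sab; pose s := [seq Some j | j <- enum J].
pose ext (c : J -> I -> R) (k : nat) : I -> R := oapp c (fun=> 0) (nth None s k).
have ext_ge k i : ext a k i <= ext b k i by rewrite /ext; case: nth => /=.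
exists (ext a), (ext b); split=> //.
  move=> x /Aab[j _ xj]; exists (index (Some j) s) => //.
  by rewrite /ext nth_index // map_f // mem_enum.
rewrite (nneseries_split 0 (size s)); last by move=> k _; exact: box_volume_ge0.
rewrite add0n [X in (_ + X)%E]eseries0 => [|k sk _]; last first.
  rewrite /ext nth_default //= (eq_bigr (fun=> 0)) => [|i _]; last by rewrite subrr.
  by rewrite (bigD1 i0) //= mul0r.
rewrite adde0 sumEFin lee_fin; apply: le_trans sab; rewrite le_eqVlt; apply/orP; left.
rewrite -(big_nth None xpredT (fun o => \prod_i (oapp b (fun=> 0) o i - oapp a (fun=> 0) o i))).
by rewrite big_map /= big_enum.
Qed.

End NullSets.

(** * Lipschitz images of cubes of smaller dimension *)

Section LipschitzImage.
Variables (R : realType) (K : finType).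

Definition cube (r : nat) : set (K -> R) := [set x | forall k, `|x k| <= r%:R].

(** Lipschitz for the sup distance, expressed by a common bound [delta] on all coordinates instead
    of a norm on [K -> R]. *)
Definition lip_on_cube r (g : (K -> R) -> R) := exists2 C, 0 <= C &
  forall x y delta, 0 <= delta -> cube r x -> cube r y ->
    (forall k, `|x k - y k| <= delta) -> `|g x - g y| <= C * delta.

(** Each coordinate is rounded down to the grid of step 1/q starting at -r. The indices run from 0
    to 2rq inclusive, since the face [x k = r] belongs to the cube. *)
Lemma cube_grid r q (x : K -> R) : cube r x -> (0 < q)%N ->
  exists g : {ffun K -> 'I_(2 * r * q).+1},
    cube r (fun k => (g k)%:R / q%:R - r%:R) /\
    forall k, `|x k - ((g k)%:R / q%:R - r%:R)| <= q%:R^-1.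
Proof.
move=> xr q0; have q0' : 0 < q%:R :> R by rewrite ltr0n.
pose t k := (x k + r%:R) * q%:R.
have t0 k : 0 <= t k.
  by rewrite mulr_ge0 //; have /ler_normlP[] := xr k; lra.
have tu k : t k <= (2 * r * q)%:R.
  by rewrite !natrM ler_pM2r //; have /ler_normlP[] := xr k; lra.
have gP k : (Num.truncn (t k) < (2 * r * q).+1)%N.
  rewrite ltnS truncn_le_nat; apply: le_lt_trans (tu k) _.
  by rewrite ltr_nat.
exists [ffun k => Ordinal (gP k)].
have itv k : (Num.truncn (t k))%:R / q%:R <= x k + r%:R /\
             x k + r%:R < (Num.truncn (t k))%:R / q%:R + q%:R^-1.
  have /andP[h1 h2] := truncn_itv (t0 k); split; first by rewrite ler_pdivrMr.
  by rewrite -[X in _ < _ + X]mul1r -mulrDl natr1 ltr_pdivlMr.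
split=> k; rewrite ffunE /=; have [h1 h2] := itv k.
  have : 0 <= (Num.truncn (t k))%:R / q%:R :> R by rewrite divr_ge0.
  by have /ler_normlP[? ?] := xr k; rewrite ler_norml; lra.
have q1 : 0 < q%:R^-1 :> R by rewrite invr_gt0.
by rewrite ler_norml; lra.
Qed.

(* The cube is cut into about [q ^ #|K|] cells of side [1/q], each mapped into a
   box of volume [O(q ^- #|I|)]. *)
Lemma lipschitz_image_null (I : finType) (f : (K -> R) -> I -> R) r :
  (#|K| < #|I|)%N -> (forall i, lip_on_cube r (f ^~ i)) ->
  lebesgue_null (f @` cube r).
Proof.
move=> KI lip.
have [i0] : exists i0 : I, True.
  by have /card_gt0P[i _] := leq_ltn_trans (leq0n _) KI; exists i.
move=> _.
have /choice[c hc] : forall i, exists C, 0 <= C /\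
    forall x y delta, 0 <= delta -> cube r x -> cube r y ->
    (forall k, `|x k - y k| <= delta) -> `|f x i - f y i| <= C * delta.
  by move=> i; have [C C0 h] := lip i; exists C.
pose C := 1 + \sum_i c i.
have c0 i : 0 <= c i by have [] := hc i.
have C1 : 1 <= C by rewrite lerDl sumr_ge0.
have cC i : c i <= C.
  rewrite /C (bigD1 i) //= addrCA lerDl addr_ge0 //; exact: sumr_ge0.
apply/lebesgue_nullP => e e0.
(* At most ((2r + 1) q)^|K| boxes of volume (2C / q)^|I| have total volume at most M q^(|K| - |I|)
   <= M / q, which the choice of [q] brings below [e]. *)
pose M : R := (2 * r + 1)%:R ^+ #|K| * (2 * C) ^+ #|I|.
have M0 : 0 < M by rewrite mulr_gt0 ?exprn_gt0 ?ltr0n ?addn1 //; lra.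
pose q := (Num.truncn (M / e)).+1.
have q0 : 0 < q%:R :> R by rewrite ltr0n.
have qM : M / q%:R <= e.
  have /andP[_ /ltW] := truncn_itv (ltW (divr_gt0 M0 e0)).
  by rewrite ler_pdivrMr // mulrC -ler_pdivrMr.
pose ctr (g : {ffun K -> 'I_(2 * r * q).+1}) : K -> R :=
  fun k => (g k)%:R / q%:R - r%:R.
apply: (@finite_box_cover R I _ _ (fun g i => f (ctr g) i - C / q%:R)
   (fun g i => f (ctr g) i + C / q%:R)) => //.
- move=> g i; have : 0 <= C / q%:R by rewrite divr_ge0 //; lra.
  lra.
- move=> _ [x xr <-]; have [g [cg xg]] := @cube_grid r q x xr isT.
  exists g => // i; have [_ h] := hc i.
  have := h x (ctr g) q%:R^-1; rewrite invr_ge0 ltW // => /(_ isT xr cg xg).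
  have : c i * q%:R^-1 <= C / q%:R by rewrite ler_wpM2r // invr_ge0 ltW.
  move=> h1 /ler_normlP[h2 h3]; apply/andP; split; lra.
- rewrite (eq_bigr (fun=> (2 * C / q%:R) ^+ #|I|)) => [|g _]; last first.
    rewrite (eq_bigr (fun=> 2 * C / q%:R)) => [|i _]; last by ring.
    by rewrite prodr_const.
  rewrite sumr_const card_ffun card_ord -[leLHS]mulr_natl; apply: le_trans qM.
  rewrite exprMn mulrA exprVn natrX.
  have h1 : (2 * r * q).+1%:R ^+ #|K| <= (2 * r + 1)%:R ^+ #|K| * q%:R ^+ #|K| :> R.
    rewrite -exprMn -natrM lerXn2r ?nnegrE ?ler0n // ler_nat.
    by rewrite mulnDl mul1n -addn1 leq_add2l.
  have h2 : q%:R ^+ #|K| / q%:R ^+ #|I| <= q%:R^-1 :> R.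
    rewrite ler_pdivrMr ?exprn_gt0 // -(subnKC KI) exprD mulrA exprS mulrA.
    rewrite mulVf ?gt_eqF // mul1r ler_peMr ?exprn_ge0 ?ler0n //.
    by rewrite exprn_ege1 // ler1n.
  have X0 : 0 <= (2 * C) ^+ #|I| by apply: exprn_ge0; lra.
  have Y0 : 0 <= (2 * r + 1)%:R ^+ #|K| :> R by apply: exprn_ge0.
  apply: (@le_trans _ _ ((2 * r + 1)%:R ^+ #|K| * q%:R ^+ #|K| *
     (2 * C) ^+ #|I| / q%:R ^+ #|I|)).
    apply: ler_wpM2r; first by rewrite invr_ge0 exprn_ge0 // ltW.
    exact: ler_wpM2r.
  rewrite /M -!mulrA ler_wpM2l // [leLHS]mulrCA ler_wpM2l //.
Qed.

End LipschitzImage.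

(** * Charts for the degenerate tuples *)

Section LipschitzCalculus.
Variables (R : realType) (K : finType) (r : nat).
Implicit Types g h : (K -> R) -> R.
Local Notation lip := (@lip_on_cube R K r).

Lemma lip_coord k : lip (fun x => x k).
Proof. by exists 1 => // x y delta _ _ _ h; rewrite mul1r. Qed.

Lemma lip_cst c : lip (fun=> c).
Proof. by exists 0 => // x y delta _ _ _ h; rewrite subrr normr0 mul0r. Qed.

Lemma lip_add g h : lip g -> lip h -> lip (fun x => g x + h x).
Proof.
move=> [C C0 hg] [D D0 hh]; exists (C + D) => [|x y d d0 xr yr xy].
  exact: addr_ge0.
rewrite opprD addrACA mulrDl; apply: le_trans (ler_normD _ _) _.
by apply: lerD; [exact: hg | exact: hh].
Qed.

Lemma lip_sum (J : finType) (g : J -> (K -> R) -> R) : (forall j, lip (g j)) ->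
  lip (fun x => \sum_j g j x).
Proof.
move=> hg; suff : forall s : seq J, lip (fun x => \sum_(j <- s) g j x) by apply.
elim=> [|j s IHs]; first by under eq_fun do rewrite big_nil; exact: lip_cst.
by under eq_fun do rewrite big_cons; exact: lip_add.
Qed.

(** Comparison with the value at the centre of the cube. This boundedness is what makes products
    Lipschitz. *)
Lemma lip_bounded g : lip g -> exists2 B, 0 <= B & forall x, cube r x -> `|g x| <= B.
Proof.
move=> [C C0 hg]; exists (`|g (fun=> 0)| + C * r%:R) => [|x xr].
  by rewrite addr_ge0 // mulr_ge0.
rewrite -[g x](subrK (g (fun=> 0))) addrC; apply: le_trans (ler_normD _ _) _.
rewrite lerD2l; apply: hg => // k; first by rewrite normr0.
by rewrite subr0.
Qed.

Lemma lip_mul g h : lip g -> lip h -> lip (fun x => g x * h x).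
Proof.
move=> lg lh; have [B B0 gB] := lip_bounded lg; have [A A0 hA] := lip_bounded lh.
move: lg lh => [C C0 hg] [D D0 hh]; exists (B * D + C * A) => [|x y d d0 xr yr xy].
  by rewrite addr_ge0 // mulr_ge0.
have -> : g x * h x - g y * h y = g x * (h x - h y) + (g x - g y) * h y by ring.
rewrite [leRHS]mulrDl; apply: le_trans (ler_normD _ _) _.
rewrite !normrM; apply: lerD.
  by rewrite -[leRHS]mulrA ler_pM // ?gB // hh.
by rewrite [leRHS]mulrAC ler_pM // ?hA // hg.
Qed.

Lemma lip_mulmx m n p (A : (K -> R) -> 'M[R]_(m, n)) (B : (K -> R) -> 'M[R]_(n, p)) :
  (forall i j, lip (fun x => A x i j)) -> (forall i j, lip (fun x => B x i j)) ->
  forall i j, lip (fun x => (A x *m B x) i j).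
Proof.
move=> hA hB i j; under eq_fun do rewrite mxE.
by apply: lip_sum => k; exact: lip_mul.
Qed.

Lemma lip_of_coord n (c : (K -> R) -> upper n -> R) :
  (forall p, lip (fun x => c x p)) -> forall i j, lip (fun x => of_coord (c x) i j).
Proof.
move=> hc i j; under eq_fun do rewrite mxE.
by case: insub => [p|]; [exact: hc | exact: lip_cst].
Qed.

Lemma frob_le n (A : 'M[R]_n) b : 0 <= b -> (forall i j, `|A i j| <= b) ->
  frob A <= (n%:R * b) ^+ 2.
Proof.
move=> b0 h; apply: (@le_trans _ _ (\sum_(i < n) \sum_(j < n) b ^+ 2)).
  apply: ler_sum => i _; apply: ler_sum => j _.
  by rewrite -[leLHS]real_normK ?num_real // ler_pXn2r ?nnegrE.
by rewrite !sumr_const card_ord -mulrnA -[leLHS]mulr_natl natrM exprMn.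
Qed.

Lemma frob_ge_coef n (A : 'M[R]_n) i j b : 0 <= b -> frob A <= b ^+ 2 -> `|A i j| <= b.
Proof.
move=> b0 h; rewrite -(ler_pXn2r (n := 2)) ?nnegrE // real_normK ?num_real //.
apply: le_trans h; rewrite /frob (bigD1 i) //= (bigD1 j) //= -addrA lerDl.
rewrite addr_ge0 ?sumr_ge0 // => [k _|k _]; first exact: sqr_ge0.
by apply: sumr_ge0 => m _; exact: sqr_ge0.
Qed.

(** On the cube the entries of [X] are bounded by some [B], hence its Frobenius norm by n B, and
    [frob_mxfun_lipschitz] applies with the scalar constant of exp on that interval. *)
Lemma lip_mxexp n (X : (K -> R) -> 'M[R]_n) : (forall x, (X x)^T = X x) ->
  (forall i j, lip (fun x => X x i j)) ->
  forall i j, lip (fun x => mxfun expR (X x) i j).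
Proof.
move=> sX hX.
have [B B0 XB] : exists2 B, 0 <= B & forall x, cube r x -> forall i j, `|X x i j| <= B.
  have /choice[c hc] : forall p : 'I_n * 'I_n, exists B, 0 <= B /\
      forall x, cube r x -> `|X x p.1 p.2| <= B.
    by move=> p; have [B B0 h] := lip_bounded (hX p.1 p.2); exists B.
  exists (\sum_p c p); first by apply: sumr_ge0 => p _; have [] := hc p.
  move=> x xr i j; have [_ /(_ x xr) h] := hc (i, j); apply: le_trans h _.
  rewrite (bigD1 (i, j)) //= lerDl; apply: sumr_ge0 => p _; by have [] := hc p.
have [C C0 XC] : exists2 C, 0 <= C & forall x y d, 0 <= d -> cube r x -> cube r y ->
    (forall k, `|x k - y k| <= d) -> forall i j, `|X x i j - X y i j| <= C * d.
  have /choice[c hc] : forall p : 'I_n * 'I_n, exists C, 0 <= C /\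
      forall x y d, 0 <= d -> cube r x -> cube r y -> (forall k, `|x k - y k| <= d) ->
      `|X x p.1 p.2 - X y p.1 p.2| <= C * d.
    by move=> p; have [D D0 h] := hX p.1 p.2; exists D.
  exists (\sum_p c p); first by apply: sumr_ge0 => p _; have [] := hc p.
  move=> x y d d0 xr yr xy i j; have [_ /(_ x y d d0 xr yr xy) h] := hc (i, j).
  apply: le_trans h _; apply: ler_wpM2r => //.
  rewrite (bigD1 (i, j)) //= lerDl; apply: sumr_ge0 => p _; by have [] := hc p.
pose b : R := n%:R * B; have b0 : 0 <= b by rewrite mulr_ge0.
move=> i j; exists (expR b * (n%:R * C)); first by rewrite !mulr_ge0 ?expR_ge0.
move=> x y d d0 xr yr xy.
have -> : mxfun expR (X x) i j - mxfun expR (X y) i j =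
    (mxfun expR (X x) - mxfun expR (X y)) i j by rewrite !mxE.
apply: frob_ge_coef; first by rewrite !mulr_ge0 ?expR_ge0.
have := @frob_mxfun_lipschitz R n expR (expR b) b (X y) (X x) (expR_ge0 b) (sX y) (sX x)
  (frob_le B0 (XB y yr)) (frob_le B0 (XB x xr)) b0 (@expR_lipschitz R b).
move=> /le_trans; apply.
have -> : (expR b * (n%:R * C) * d) ^+ 2 = expR b ^+ 2 * (n%:R * (C * d)) ^+ 2 by ring.
apply: ler_wpM2l; first exact: sqr_ge0.
apply: frob_le => [|k m]; first exact: mulr_ge0.
by have := XC x y d d0 xr yr xy k m; rewrite !mxE.
Qed.

End LipschitzCalculus.

(** * Hyperplanes containing the logarithms, and the resulting parametrization *)

Section Hyperplane.
Variables (R : realType) (n l : nat).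

(** The map [v - projv U v] kills [U] but is not zero, so one of its coordinates is the functional
    sought. *)
Lemma subspace_annihilator m (U : {vspace 'rV[R]_m}) : (\dim U < m)%N ->
  exists w : 'I_m -> R, (exists k, w k != 0) /\
    forall v, v \in U -> \sum_k w k * v 0 k = 0.
Proof.
move=> dU; have [v vU] : exists v, v \notin U.
  apply: contrapT => /forallNP h; have : (fullv <= U)%VS.
    by apply/subvP => v _; apply/negPn/negP; exact: h.
  by move=> /dimvS; rewrite dimvf /dim /= mul1n leqNgt dU.
pose q : 'rV[R]_m -> 'rV[R]_m := fun v => v - projv U v.
have qE (u : 'rV[R]_m) k0 : \sum_k q (delta_mx 0 k) 0 k0 * u 0 k = q u 0 k0.
  rewrite {2}[u]row_sum_delta /q linear_sum -sumrB summxE; apply: eq_bigr => k _.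
  by rewrite linearZ /= -scalerBr [RHS]mxE mulrC.
have [k0 qv0] : exists k0, q v 0 k0 != 0.
  apply: contrapT => /forallNP h; case/negP: vU.
  have -> : v = projv U v.
    apply/eqP; rewrite -subr_eq0; apply/eqP/rowP => k; rewrite [RHS]mxE.
    by apply/eqP/negPn/negP; exact: h.
  exact: memv_proj.
exists (fun k => q (delta_mx 0 k) 0 k0); split.
  apply: contrapT => /forallNP h; case/negP: qv0; rewrite -qE big1 // => k _.
  by have /negP/negPn/eqP -> := h k; rewrite mul0r.
by move=> u uU; rewrite qE /q projv_id // subrr mxE.
Qed.

(** For [S] the inverse square root of P, this sends [spd_log P Q] to the coordinates of
    [mxlog (whiten P Q)]. *)
Definition congr_coord (S A : 'M[R]_n) : 'rV[R]_#|{: upper n}| :=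
  \row_k (S *m A *m S) (val (enum_val k)).1 (val (enum_val k)).2.

Fact congr_coord_linear S : linear (congr_coord S).
Proof.
move=> a A B; rewrite /congr_coord mulmxDr mulmxDl -scalemxAr -scalemxAl.
by apply/rowP => k; rewrite !mxE.
Qed.

HB.instance Definition _ S := GRing.isLinear.Build R 'M[R]_n 'rV[R]_#|{: upper n}| _
  (congr_coord S) (congr_coord_linear S).

(** A linear image of the span of the [spd_log P (Rs i)] still has dimension below m, so a nonzero
    functional on coordinates annihilates it. *)
Lemma degenerate_hyperplane (Rs : 'I_l -> Sym R n) (P : Sym R n) :
  SPD P -> (log_rank Rs P < symdim n)%N ->
  exists w : upper n -> R, (exists p, w p != 0) /\
    forall i, \sum_p w p * mxlog (whiten P (Rs i)) (val p).1 (val p).2 = 0.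
Proof.
move=> /SPD_posdef pP; rewrite /log_rank -card_upper => dL.
set L := [seq _ | _ : _] in dL.
pose f := linfun (congr_coord (invmx (mxsqrt P))).
have [|w [[k wk] hw]] := @subspace_annihilator _ (f @: <<L>>)%VS.
  by apply: leq_ltn_trans dL; rewrite -(limg_ker_dim f <<L>>) leq_addl.
exists (fun p => w (enum_rank p)); split; first by exists (enum_val k); rewrite enum_valK.
move=> i; have /hw : f (spd_log P (Rs i)) \in (f @: <<L>>)%VS.
  by apply: memv_img; apply: memv_span; apply: map_f; rewrite mem_enum.
rewrite (reindex (@enum_rank (upper n))) /=; last by apply: onW_bij; exact: enum_rank_bij.
under eq_bigr => p _.
  rewrite lfunE /= mxE enum_rankK /spd_log.
  rewrite !mulmxA mulVmx ?mxsqrt_unit // mul1mx -mulmxA mulmxV ?mxsqrt_unit // mulmx1.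
  over.
by [].
Qed.

Section Chart.
Variable j : upper n.

Definition others := {p : upper n | p != j}.

(** [j] is the coordinate for which the hyperplane equation is solved, so the three summands have m,
    m - 1 and l (m - 1) elements. *)
Definition chart_param := (upper n + (others + 'I_l * others))%type.

(* [x] encodes a square root [S] of the base point, the coefficients of the
   hyperplane [z_j = \sum_(p != j) a_p z_p], and one point of this hyperplane for
   each [i : 'I_l]. *)
Definition chart_sqrt (x : chart_param -> R) : Sym R n := of_coord (fun p => x (inl p)).

Definition chart_log (x : chart_param -> R) (i : 'I_l) : Sym R n :=
  of_coord (fun p => if insub p is Some p' then x (inr (inr (i, p')))
    else \sum_p' x (inr (inl p')) * x (inr (inr (i, p')))).

Definition chart (x : chart_param -> R) (ip : 'I_l * upper n) : R :=
  (sym_mx (chart_sqrt x) *m mxfun expR (chart_log x ip.1) *m chart_sqrt x)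
    (val ip.2).1 (val ip.2).2.

Lemma chart_lipschitz r ip : lip_on_cube r (chart ^~ ip).
Proof.
rewrite /chart; apply: lip_mulmx; first apply: lip_mulmx.
- by apply: lip_of_coord => p; exact: lip_coord.
- apply: lip_mxexp => [x|]; first exact: tr_sym.
  apply: lip_of_coord => p; case: insub => [p'|]; first exact: lip_coord.
  by apply: lip_sum => p'; apply: lip_mul; exact: lip_coord.
- by apply: lip_of_coord => p; exact: lip_coord.
Qed.

(** The inequality m + (m - 1) + l (m - 1) < l m amounts to 2m - 1 < l; the index [j] witnesses m >
    0. *)
Lemma card_chart_param : (2 * symdim n <= l)%N ->
  (#|{: chart_param}| < #|{: 'I_l * upper n}|)%N.
Proof.
move=> hl; have cO : #|{: others}| = #|{: upper n}|.-1.
  exact: etrans (card_sig (fun p => p != j)) (cardC1 j).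
rewrite !card_sum !card_prod card_ord cO card_upper.
have : (0 < symdim n)%N by rewrite -card_upper; apply/card_gt0P; exists j.
case: (symdim n) hl => [//|m] hl _ /=; lia.
Qed.

(** The parameter space is exhausted by countably many cubes, each with a null image. *)
Lemma chart_null : (2 * symdim n <= l)%N -> lebesgue_null (range chart).
Proof.
move=> hl; apply: (@sub_lebesgue_null _ _ _ (\bigcup_r (chart @` cube r))).
  move=> _ [x _ <-]; exists (Num.truncn (\sum_k `|x k|)).+1 => //; exists x => // k.
  have s0 : 0 <= \sum_k `|x k| by apply: sumr_ge0.
  have /andP[_ /ltW] := truncn_itv s0; apply: le_trans.
  by rewrite (bigD1 k) //= lerDl sumr_ge0.
apply: lebesgue_null_bigcup => r; apply: lipschitz_image_null.
  exact: card_chart_param.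
exact: chart_lipschitz.
Qed.

(** As [w j] is nonzero, the equation can be solved for coordinate [j], with coefficients - w_p /
    w_j. *)
Lemma chart_surj (S : Sym R n) (X : 'I_l -> Sym R n) (w : upper n -> R) :
  w j != 0 -> (forall i, \sum_p w p * sym_coord (X i) p = 0) ->
  range chart (fun ip =>
    (sym_mx S *m mxfun expR (X ip.1) *m S) (val ip.2).1 (val ip.2).2).
Proof.
move=> wj hw.
pose x (k : chart_param) : R := match k with
  | inl p => sym_coord S p
  | inr (inl p') => - w (val p') / w j
  | inr (inr (i, p')) => sym_coord (X i) (val p') end.
exists x => //; apply/funext => ip; rewrite /chart.
have -> : chart_sqrt x = S by apply: sym_coord_inj => p; rewrite of_coordK.
suff -> : forall i, chart_log x i = X i by [].
move=> i; apply: sym_coord_inj => p; rewrite of_coordK.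
case: insubP => [p' _ <- //|]; rewrite negbK => /eqP ->.
have := hw i; rewrite (bigD1 j) //= => /eqP; rewrite addr_eq0 => /eqP h.
apply: (mulfI wj); rewrite h mulr_sumr -sumrN.
rewrite [RHS](reindex_omap (val : others -> upper n) insub) /=; last first.
  by move=> p0 pj; rewrite insubT.
apply: eq_big => [p'|p' _]; first by rewrite valK eqxx (valP p').
by field.
Qed.

End Chart.
End Hyperplane.

(** * From full rank to an injective differential, and from deficient rank to a chart *)

Section Main.
Variables (R : realType) (n l : nat).
Implicit Types (Rs : 'I_l -> Sym R n) (P V : Sym R n).

Lemma span_eq0 m p (phi : 'M[R]_(m, p) -> R) (X : seq 'M[R]_(m, p)) v :
  linear_for *%R phi -> {in X, forall x, phi x = 0} -> v \in <<X>>%VS -> phi v = 0.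
Proof.
move=> /linear_formP[phi0 phiD phiZ] X0.
rewrite -[X]/(tval (in_tuple X)) => /coord_span ->.
rewrite (big_morph phi phiD phi0) big1 // => i _.
by rewrite phiZ X0 ?mulr0 // mem_nth.
Qed.

(** The span is taken among all square matrices, but it lies in the copy of [Sym R n] there, which
    has dimension m; equal dimensions force equality. *)
Lemma full_log_rank_span Rs P : (forall i, SPD (Rs i)) -> SPD P ->
  (symdim n <= log_rank Rs P)%N ->
  forall V, sym_mx V \in <<[seq spd_log P (Rs i) | i : 'I_l]>>%VS.
Proof.
move=> pRs pP full V; pose f := linfun (\val : Sym R n -> 'M[R]_n).
set U := <<_>>%VS.
have dT : \dim (limg f) = symdim n.
  rewrite limg_dim_eq ?dim_Sym //; apply/eqP; rewrite -subv0.
  apply/subvP => A; rewrite memv_cap memv_ker lfunE /= => /andP[_ /eqP A0].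
  by rewrite memv0; apply/eqP/val_inj.
have UT : (U <= limg f)%VS.
  apply/span_subvP => _ /mapP[i _ ->].
  have sL := spd_log_sym (SPD_posdef pP) (tr_sym (Rs i)).
  have -> : spd_log P (Rs i) = f (@MkSym R n (spd_log P (Rs i)) (introT eqP sL)).
    by rewrite lfunE.
  exact: memv_img (memvf _).
have /eqP -> : U == limg f by rewrite eqEdim UT dT.
have -> : sym_mx V = f V by rewrite lfunE.
exact: memv_img (memvf _).
Qed.

(** If the differential kills V, the form A |-> Tr (P^-1 A P^-1 V) vanishes on all log_P(R_i), hence
    on all symmetric matrices. At A = P V P its value is Tr (V V) = [frob V], so V = 0. *)
Lemma full_log_rank_locally_invertible Rs P : (forall i, SPD (Rs i)) -> SPD P ->
  (symdim n <= log_rank Rs P)%N -> locally_invertible_at (sqdist_map Rs) P.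
Proof.
move=> pRs pP full; have [dF dE] := sqdist_differentiable pRs pP; split=> //.
rewrite limg_dim_eq ?dim_Sym //; apply/eqP; rewrite -subv0.
apply/subvP => V; rewrite memv_cap memv_ker lfunE /= => /andP[_ /eqP].
rewrite dE memv0 => /rowP V0.
have uP := posdef_unit (SPD_posdef pP).
pose phi (A : 'M[R]_n) : R := \tr (invmx P *m A *m invmx P *m V).
have phi_lin : linear_for *%R phi.
  move=> a A B; rewrite /phi mulmxDr !mulmxDl mxtraceD.
  by rewrite -scalemxAr -!scalemxAl mxtraceZ.
have sPVP : sym_mx P *m sym_mx V *m sym_mx P \in @is_symmx R n.
  by apply/eqP; rewrite !trmx_mul !tr_sym mulmxA.
have : phi (MkSym sPVP) = 0.
  apply: span_eq0 phi_lin _ (full_log_rank_span pRs pP full _) => _ /mapP[i _ ->].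
  have := V0 i; rewrite !mxE => /eqP; rewrite oppr_eq0 mulf_eq0 pnatr_eq0 /=.
  by move=> /eqP.
rewrite /phi /= !mulmxA mulVmx // mul1mx -[_ *m P *m _]mulmxA mulmxV // mulmx1.
rewrite -{2}(tr_sym V) -frobE => fV; apply/eqP/val_inj/matrixP => i j /=.
rewrite mxE; apply/eqP; rewrite -normr_le0; apply: frob_ge_coef => //.
by rewrite fV expr0n.
Qed.

(** Take S the square root of P and X_i the logarithm of the whitened R_i, so that S exp(X_i) S =
    R_i; the pivot [j] is any index with nonzero weight. *)
Lemma degenerate_in_chart Rs P : (forall i, SPD (Rs i)) -> SPD P ->
  (log_rank Rs P < symdim n)%N -> exists j, range (@chart R n l j) (tuple_coord Rs).
Proof.
move=> pRs pP /(degenerate_hyperplane pP)[w [[j wj] hw]]; exists j.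
have pPm := SPD_posdef pP; have pQ i := SPD_posdef (pRs i).
have sX i : mxlog (whiten P (Rs i)) \in @is_symmx R n.
  by apply/eqP/mxlog_sym/(whiten_sym pPm)/tr_sym.
have sS : mxsqrt P \in @is_symmx R n by apply/eqP; exact: mxsqrt_sym.
have := @chart_surj R n l j (MkSym sS) (fun i => MkSym (sX i)) w wj hw.
set c := (X in range _ X) => hc; suff -> : tuple_coord Rs = c by [].
apply/funext => -[i p]; rewrite /c /=.
by rewrite mxfun_expR_log ?mxsqrt_whiten //; exact: posdef_whiten.
Qed.

End Main.

Theorem theorem5 (R : realType) (n l : nat) (hn : (1 <= n)%N)
    (hl : (2 * symdim n <= l)%N) :
  almost_all_SPD (fun Rs : 'I_l -> Sym R n =>
    degenerate_set Rs = set0 /\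
    (forall P : Sym R n, SPD P -> locally_invertible_at (sqdist_map Rs) P)).
Proof.
(* Default for the codes that decode to no index, so that the finitely many charts form a sequence;
   [hn] provides the entry (0, 0). *)
pose j0 : upper n := exist _ (Ordinal hn, Ordinal hn) (leqnn 0).
pose F k := range (@chart R n l (odflt j0 (unpickle k))).
apply: (@sub_lebesgue_null _ _ _ (\bigcup_k F k)); last first.
  by apply: lebesgue_null_bigcup => k; exact: chart_null.
move=> _ [Rs [pRs bad] <-].
suff [P [pP low]] : exists P : Sym R n, SPD P /\ (log_rank Rs P < symdim n)%N.
  have [j hj] := degenerate_in_chart pRs pP low.
  by exists (pickle j) => //; rewrite /F pickleK.
(* If no P had deficient rank, both conclusions would hold for [Rs], against [bad]. *)
apply: contrapT => /forallNP full; apply: bad; split.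
  by apply/seteqP; split=> // P /full.
move=> P pP; apply: full_log_rank_locally_invertible => //.
by rewrite leqNgt; apply/negP => low; exact: (full P).
Qed.
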